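(* Let $(M,g)$ be an oriented Riemannian 4-manifold with curvature operator $\hat R_g$, let $T$ be a unit length vector field on $M$, let $*_L$ be the Hodge star operator of the Lorentzian metric $g_L:=g-2T^\flat\otimes T^\flat$, and let $\hat S_g:=\frac12(\hat R_g-*_L\circ\hat R_g\circ *_L)$, which commutes with $*_L$ and hence is a complex-linear map $\hat S_g\colon\Lambda^2_{\mathbb C}\to\Lambda^2_{\mathbb C}$. Define $$\mathrm{sec}_{L\text{-}\hat S}(P):=\epsilon_L(P)\langle\hat S_gP,P\rangle_{g_L},\qquad P\in G_+(p)\cup G_-(p).$$ Then for every $p\in M$: (a) $\mathrm{sec}_{L\text{-}\hat S}(P^{\perp_L})=\mathrm{sec}_{L\text{-}\hat S}(P)$ for all $P\in G_+(p)\cup G_-(p)$. (b) $\hat S_g\colon\Lambda^2_{\mathbb C}\to\Lambda^2_{\mathbb C}$ is similar to one of $$\begin{bmatrix}\lambda_1&0&0\\0&\lambda_2&0\\0&0&\lambda_3\end{bmatrix}\ (\text{Type I}),\qquad \begin{bmatrix}\lambda_1&0&0\\0&\lambda_2&1\\0&0&\lambda_2\end{bmatrix}\ (\text{Type II}),\qquad \begin{bmatrix}\lambda_1&1&0\\0&\lambda_1&1\\0&0&\lambda_1\end{bmatrix}\ (\text{Type III}),$$ according to the Petrov Type of $g$ at $p$, with $\lambda_1,\lambda_2,\lambda_3\in\mathbb C$ not necessarily distinct. (c) If $P\in G_+(p)\cup G_-(p)$ is an eigenvector of $\hat S_g\colon\Lambda^2_{\mathbb C}\to\Lambda^2_{\mathbb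 C}$ that is orthogonal to $T$ or contains $T$, then $P$ is a critical point of $\mathrm{sec}_{L\text{-}\hat S}$.
   Context: Write $T^\flat := g(T,\cdot)$ and $\Lambda^2 := \Lambda^2(T_pM)$. For a metric $m$ of any signature, $\Lambda^2$ carries the inner product $\langle v_1\wedge w_1, v_2\wedge w_2\rangle_m := m(v_1,v_2)m(w_1,w_2) - m(v_1,w_2)m(w_1,v_2)$, and the Hodge star $*_m\colon\Lambda^2\to\Lambda^2$ is defined by $\xi\wedge *_m\eta = \langle\xi,\eta\rangle_m\, dV$, where $dV = e_1\wedge e_2\wedge e_3\wedge e_4$ for any oriented $m$-orthonormal basis. The Hodge star $*_L$ of $g_L$ satisfies $*_L^2=-1$, and $\Lambda^2_{\mathbb C}$ denotes $\Lambda^2$ regarded as a 3-dimensional complex vector space via $i\xi:=*_L\xi$. Curvature convention: $R(a,b,c,d) := g(\nabla_a\nabla_b c-\nabla_b\nabla_a c-\nabla_{[a,b]}c,d)$; the curvature operator $\hat R_g\colon\Lambda^2\to\Lambda^2$ of $g$ is defined by $\langle\hat R_g(v\wedge w),x\wedge y\rangle_g = -R(v,w,x,y)$. $G_{\pm}(p)\subseteq\Lambda^2(T_pM)$ is the set (a 4-dimensional manifold) of decomposable 2-vectors $P$ with $\langle P,P\rangle_{g_L}=\pm1$, i.e. the oriented 2-planes nondegenerate for $g_L$; $\epsilon_L(P):=\langle P,P\rangle_{g_L}=\pm1$ for $P\in G_{\pm}(p)$, and $P^{\perp_L}:=*_LP$. Critical points of $\mathrm{sec}_{L\text{-}\hat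 S}$ are taken as critical points of a smooth function on $G_+(p)\cup G_-(p)$. $g$ has Petrov Type I, II, or III at $p$ (with respect to $T$) if $\hat S_g\colon\Lambda^2_{\mathbb C}\to\Lambda^2_{\mathbb C}$ has, respectively, 3, 2, or 1 linearly independent complex eigenvectors at $p$. *)

(* Defs.v *)
From HB Require Import structures.
From mathcomp Require Import all_boot all_order all_algebra.
From mathcomp Require Import all_classical all_reals all_analysis.
From mathcomp Require Import perm complex ring.

Set Implicit Arguments.
Unset Strict Implicit.
Unset Printing Implicit Defensive.

Import Order.TTheory GRing.Theory Num.Theory.
Import numFieldNormedType.Exports.

Local Open Scope classical_set_scope.
Local Open Scope ring_scope.

(* Vectors are rows: a tangent vector is the row of its components in the
   coordinate frame of a chart, and a 4 x 4 matrix [m] is the bilinear form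
   with components [m i j]. *)

Section SmoothFunctions.
Variable R : realType.

Definition coord_vec (i : 'I_4) : 'rV[R]_4 := delta_mx 0 i.

Definition partial (i : 'I_4) (f : 'rV[R]_4 -> R) : 'rV[R]_4 -> R :=
  fun x => 'D_(coord_vec i) f x.

(* C^k on [U]; meant for open [U], the values of [f] outside [U] being then
   irrelevant. *)
Fixpoint Ck (k : nat) (U : set 'rV[R]_4) (f : 'rV[R]_4 -> R) : Prop :=
  (forall x, U x -> {for x, continuous f}) /\
  if k is k'.+1 then
    forall i : 'I_4, (forall x, U x -> derivable f x (coord_vec i)) /\
                     Ck k' U (partial i f)
  else True.

Definition smooth (U : set 'rV[R]_4) (f : 'rV[R]_4 -> R) : Prop :=
  forall k, Ck k U f.

End SmoothFunctions.

(* A smooth 4-manifold with an oriented atlas: the orientation is the one for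
   which all the charts of the atlas are positive. *)
Record oriented_manifold4 (R : realType) := OrientedManifold4 {
  carrier :> topologicalType;
  chart_index : Type;
  chart_dom : chart_index -> set carrier;
  chart : chart_index -> carrier -> 'rV[R]_4;
  chart_inv : chart_index -> 'rV[R]_4 -> carrier;
  manifold_hausdorff : hausdorff_space carrier;
  manifold_second_countable : @second_countable carrier;
  chart_cover : forall p, exists a, chart_dom a p;
  chart_dom_open : forall a, open (chart_dom a);
  chart_img_open : forall a, open (chart a @` chart_dom a);
  chartK : forall a p, chart_dom a p -> chart_inv a (chart a p) = p;
  chart_continuous : forall a p, chart_dom a p -> {for p, continuous (chart a)};
  chart_inv_continuous : forall a x, (chart a @` chart_dom a) x ->
    {for x, continuous (chart_inv a)};
  transition_smooth : forall a b j,
    smooth (chart a @` (chart_dom a `&` chart_dom b))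
           (fun x => chart b (chart_inv a x) 0 j);
  transition_oriented : forall a b x,
    (chart a @` (chart_dom a `&` chart_dom b)) x ->
    0 < \det (jacobian (chart b \o chart_inv a) x)
}.

Section Fields.
Variables (R : realType) (M : oriented_manifold4 R).

Definition chart_img (a : chart_index M) : set 'rV[R]_4 :=
  chart a @` chart_dom a.

Definition overlap (a b : chart_index M) : set 'rV[R]_4 :=
  chart a @` (chart_dom a `&` chart_dom b).

Definition transition (a b : chart_index M) : 'rV[R]_4 -> 'rV[R]_4 :=
  chart b \o chart_inv a.

(* Tensor fields are given by their components in each chart, as functions of
   the coordinates; [v *m jacobian (transition a b) x] is the row of components
   in the chart [b] of the vector whose row of components in [a] is [v]. *)
Record riemannian_metric := RiemannianMetric {
  metric : chart_index M -> 'rV[R]_4 -> 'M[R]_4;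
  metric_smooth : forall a i j, smooth (chart_img a) (fun x => metric a x i j);
  metric_sym : forall a x, chart_img a x -> (metric a x)^T = metric a x;
  metric_pos : forall a x, chart_img a x ->
    forall v : 'rV[R]_4, v != 0 -> 0 < (v *m metric a x *m v^T) 0 0;
  metric_compat : forall a b x, overlap a b x ->
    metric a x = jacobian (transition a b) x *m metric b (transition a b x)
                   *m (jacobian (transition a b) x)^T
}.

Record vector_field := VectorField {
  field_comp : chart_index M -> 'rV[R]_4 -> 'rV[R]_4;
  field_smooth : forall a i,
    smooth (chart_img a) (fun x => field_comp a x 0 i);
  field_compat : forall a b x, overlap a b x ->
    field_comp b (transition a b x) =
    field_comp a x *m jacobian (transition a b) x
}.

End Fields.

Section Curvature.
Variables (R : realType).

Definition inner (m : 'M[R]_4) (v w : 'rV[R]_4) : R := (v *m m *m w^T) 0 0.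

(* Levi-Civita connection and curvature of a metric [g] on an open set of R^4,
   for vector fields [X Y Z W] given by their components. *)
Variable g : 'rV[R]_4 -> 'M[R]_4.

Definition christoffel (k i j : 'I_4) (x : 'rV[R]_4) : R :=
  2^-1 * \sum_(l < 4) invmx (g x) k l *
    (partial i (fun y => g y j l) x + partial j (fun y => g y i l) x
     - partial l (fun y => g y i j) x).

Definition nabla (X Y : 'rV[R]_4 -> 'rV[R]_4) : 'rV[R]_4 -> 'rV[R]_4 :=
  fun x => \row_(k < 4)
    ('D_(X x) (fun y => Y y 0 k) x
     + \sum_(i < 4) \sum_(j < 4) X x 0 i * Y x 0 j * christoffel k i j x).

Definition lie_bracket (X Y : 'rV[R]_4 -> 'rV[R]_4) : 'rV[R]_4 -> 'rV[R]_4 :=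
  fun x => \row_(k < 4) ('D_(X x) (fun y => Y y 0 k) x
                         - 'D_(Y x) (fun y => X y 0 k) x).

Definition curvature_fields (X Y Z W : 'rV[R]_4 -> 'rV[R]_4)
    (x : 'rV[R]_4) : R :=
  inner (g x) (nabla X (nabla Y Z) x - nabla Y (nabla X Z) x
              - nabla (lie_bracket X Y) Z x) (W x).

(* On tangent vectors: by tensoriality any extension to vector fields can be
   used; we take the one with constant components. *)
Definition curvature (x a b c d : 'rV[R]_4) : R :=
  curvature_fields (fun=> a) (fun=> b) (fun=> c) (fun=> d) x.

End Curvature.

(* Lambda^2 of R^4 as antisymmetric matrices: the entry (i, j) is the
   coefficient of d_i /\ d_j. *)
Definition antisym_mx (R : realType) : {pred 'M[R]_4} :=
  fun A => A^T == - A.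

Lemma antisym_mx_submod (R : realType) : submod_closed (@antisym_mx R).
Proof.
split=> [|a A B /eqP hA /eqP hB]; first by apply/eqP; rewrite trmx0 oppr0.
by apply/eqP; rewrite linearD linearZ /= hA hB scalerN opprD.
Qed.

HB.instance Definition _ (R : realType) :=
  GRing.isSubmodClosed.Build R 'M[R]_4 (@antisym_mx R)
    (@antisym_mx_submod R).

Record bivector (R : realType) := Bivector {
  bimx :> 'M[R]_4;
  bimx_antisym : bimx \in @antisym_mx R
}.

HB.instance Definition _ (R : realType) := [isSub for @bimx R].
HB.instance Definition _ (R : realType) := [Choice of bivector R by <:].
HB.instance Definition _ (R : realType) :=
  [SubChoice_isSubLmodule of bivector R by <:].

Section Bivectors.
Variable R : realType.
Implicit Types (v w : 'rV[R]_4) (m : 'M[R]_4) (xi zeta P : bivector R).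

Lemma wedge_antisym v w :
  v^T *m w - w^T *m v \in @antisym_mx R.
Proof. by apply/eqP; rewrite linearB /= !trmx_mul !trmxK opprB. Qed.

Definition wedge v w : bivector R := Bivector (wedge_antisym v w).

(* The bilinear extension of the inner product on decomposable bivectors, see
   [biform_wedge]. *)
Definition biform m xi zeta : R :=
  2^-1 * \sum_(i < 4) \sum_(j < 4) \sum_(k < 4) \sum_(l < 4)
    xi i j * zeta k l * m i k * m j l.

(* The coefficient of xi /\ zeta on d_1 /\ d_2 /\ d_3 /\ d_4; Lambda^4 is
   identified with the scalars through this coefficient, so that the volume
   form e_1 /\ e_2 /\ e_3 /\ e_4 of a frame e becomes [frame_det e]. *)
Definition wedge22 xi zeta : R :=
  4^-1 * \sum_(s : 'S_4)
    (-1) ^+ s * (xi (s 0) (s 1) * zeta (s 2%:R) (s 3%:R)).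

Definition frame_det (e : 'I_4 -> 'rV[R]_4) : R := \det (\matrix_i e i).

Definition oriented_orthonormal m (e : 'I_4 -> 'rV[R]_4) : Prop :=
  [/\ forall i, inner m (e i) (e i) = 1 \/ inner m (e i) (e i) = -1,
      forall i j, i != j -> inner m (e i) (e j) = 0
    & 0 < frame_det e].

Lemma innerE m v w :
  inner m v w = \sum_(i < 4) \sum_(k < 4) v 0 i * m i k * w 0 k.
Proof.
rewrite /inner mxE exchange_big; apply: eq_bigr => k _ /=.
by rewrite !mxE mulr_suml.
Qed.

Lemma inner_mul m v1 w1 v2 w2 :
  inner m v1 v2 * inner m w1 w2 =
  \sum_(i < 4) \sum_(j < 4) \sum_(k < 4) \sum_(l < 4)
    (v1 0 i * w1 0 j) * (v2 0 k * w2 0 l) * m i k * m j l.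
Proof.
rewrite !innerE big_distrlr /=; apply: eq_bigr => i _; apply: eq_bigr => j _.
rewrite big_distrlr /=; apply: eq_bigr => k _; apply: eq_bigr => l _.
by ring.
Qed.

Lemma biform_wedge m v1 w1 v2 w2 :
  biform m (wedge v1 w1) (wedge v2 w2) =
  inner m v1 v2 * inner m w1 w2 - inner m v1 w2 * inner m w1 v2.
Proof.
have E : inner m v1 v2 * inner m w1 w2 + inner m w1 w2 * inner m v1 v2
    - inner m v1 w2 * inner m w1 v2 - inner m w1 v2 * inner m v1 w2
  = 2 * biform m (wedge v1 w1) (wedge v2 w2).
  rewrite !inner_mul /biform mulrA mulfV ?pnatr_eq0// mul1r.
  do 4![rewrite -?sumrN -!big_split /=; apply: eq_bigr => ? _].
  by rewrite !mxE !big_ord1 !mxE; ring.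
apply: (@mulfI _ 2); first by rewrite pnatr_eq0.
by rewrite -E; ring.
Qed.

Lemma wedge22_wedge (e : 'I_4 -> 'rV[R]_4) :
  wedge22 (wedge (e 0) (e 1)) (wedge (e 2%:R) (e 3%:R)) = frame_det e.
Proof.
pose D (f : 'I_4 -> 'rV[R]_4) := \sum_(s : 'S_4)
  (-1) ^+ s * (f 0 0 (s 0) * f 1 0 (s 1) * f 2%:R 0 (s 2%:R) * f 3%:R 0 (s 3%:R)).
have DE f : frame_det f = D f.
  rewrite /frame_det /determinant; apply: eq_bigr => s _; congr (_ * _).
  rewrite !big_ord_recl big_ord0 !mxE mulr1 !mulrA.
  have -> : lift ord0 (lift ord0 (lift ord0 ord0)) = 3%:R :> 'I_4.
    exact: val_inj.
  have -> : lift ord0 (lift ord0 ord0) = 2%:R :> 'I_4 by exact: val_inj.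
  by have -> : lift ord0 ord0 = 1 :> 'I_4 by exact: val_inj.
have swap f (i j : 'I_4) : i != j -> D (f \o tperm i j) = - D f.
  move=> ij; rewrite -!DE /frame_det -mulN1r.
  rewrite (_ : \det _ = \det (row_perm (tperm i j) (\matrix_i f i))).
    by rewrite row_permE det_mulmx det_perm odd_tperm ij expr1.
  by congr (\det _); apply/matrixP => a b; rewrite !mxE.
rewrite DE; apply: (@mulfI _ 4); first by rewrite pnatr_eq0.
rewrite /wedge22 mulrA mulfV ?pnatr_eq0// mul1r.
have -> : 4 * D e = D e - D (e \o tperm 0 1) - D (e \o tperm 2%:R 3%:R)
    + D ((e \o tperm 0 1) \o tperm 2%:R 3%:R).
  by rewrite !swap //; ring.
rewrite /D -!sumrN -!big_split /=; apply: eq_bigr => s _.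
have tD a b c : a != c -> b != c -> tperm a b c = c :> 'I_4 by exact: tpermD.
rewrite /= !(tD 2%:R 3%:R 0, tD 2%:R 3%:R 1, tD 0 1 2%:R, tD 0 1 3%:R,
             tpermL, tpermR) //= !mxE !big_ord1 !mxE.
move: ((-1) ^+ s) (e 0 0 (s 0)) (e 0 0 (s 1)) (e 1 0 (s 0)) (e 1 0 (s 1))
  (e 2%:R 0 (s 2%:R)) (e 2%:R 0 (s 3%:R)) (e 3%:R 0 (s 2%:R))
  (e 3%:R 0 (s 3%:R)) => *.
by ring.
Qed.

Definition is_hodge_star m (star : bivector R -> bivector R) : Prop :=
  forall e, oriented_orthonormal m e ->
  forall xi zeta, wedge22 xi (star zeta) = biform m xi zeta * frame_det e.

Definition decomposable P : Prop := exists v w, P = wedge v w.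

(* For decomposable P <> 0, the vectors of the plane P. *)
Definition in_plane P (u : 'rV[R]_4) : Prop :=
  exists v w (s t : R), P = wedge v w /\ u = s *: v + t *: w.

Definition unit_planes m : set (bivector R) :=
  [set P | decomposable P /\ (biform m P P = 1 \/ biform m P P = -1)].

(* [G] is meant to be an embedded submanifold of Lambda^2: the differential at
   P of the restriction of [f] vanishes iff the derivative of [f] vanishes
   along every smooth curve in [G] through P. *)
Definition smooth_curve (c : R -> bivector R) : Prop :=
  forall (i j : 'I_4) (n : nat) (t : R),
    derivable (derive1n n (fun u : R => c u i j)) t 1.

Definition is_critical_point (G : set (bivector R)) (f : bivector R -> R) P
    : Prop :=
  forall c : R -> bivector R,
    smooth_curve c -> (forall t, G (c t)) -> c 0 = P ->
    is_derive (0 : R) (1 : R) (f \o c) 0.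

(* Lambda^2 with the complex scalar action for which i acts as [star]. *)
Definition cscale (star : bivector R -> bivector R) (z : R[i]) xi
    : bivector R :=
  complex.Re z *: xi + complex.Im z *: star xi.

Section ComplexLinearAlgebra.
Variables (star S : bivector R -> bivector R).

Definition ceigenvector xi : Prop :=
  xi <> 0 /\ exists z : R[i], S xi = cscale star z xi.

Definition cindependent n (b : 'I_n -> bivector R) : Prop :=
  forall z : 'I_n -> R[i],
    \sum_(i < n) cscale star (z i) (b i) = 0 -> forall i, z i = 0.

Definition cbasis n (b : 'I_n -> bivector R) : Prop :=
  cindependent b /\
  forall xi, exists z : 'I_n -> R[i], xi = \sum_(i < n) cscale star (z i) (b i).

Definition clinear : Prop :=
  forall (z : R[i]) xi zeta,
    S (cscale star z xi + zeta) = cscale star z (S xi) + S zeta.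

Definition csimilar (A : 'M[R[i]]_3) : Prop :=
  exists b : 'I_3 -> bivector R, cbasis b /\
    forall j, S (b j) = \sum_(i < 3) cscale star (A i j) (b i).

Definition has_independent_eigenvectors (n : nat) : Prop :=
  exists b : 'I_n -> bivector R,
    cindependent b /\ forall i, ceigenvector (b i).

(* The maximal number of linearly independent eigenvectors is n. *)
Definition eigenvector_number (n : nat) : Prop :=
  has_independent_eigenvectors n /\ ~ has_independent_eigenvectors n.+1.

Definition petrov_type_I := eigenvector_number 3.
Definition petrov_type_II := eigenvector_number 2.
Definition petrov_type_III := eigenvector_number 1.

End ComplexLinearAlgebra.

Definition mx3 (C : pzRingType) (rows : seq (seq C)) : 'M[C]_3 :=
  \matrix_(i < 3, j < 3) nth 0 (nth [::] rows i) j.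

End Bivectors.

Section Lorentz.
Variable R : realType.

(* g - 2 T^flat (x) T^flat, with T^flat = g(T, .) *)
Definition lorentz_metric (g : 'M[R]_4) (T : 'rV[R]_4) : 'M[R]_4 :=
  g - 2 *: ((T *m g)^T *m (T *m g)).

Definition is_curvature_operator (g : 'rV[R]_4 -> 'M[R]_4) (x : 'rV[R]_4)
    (Rhat : bivector R -> bivector R) : Prop :=
  forall v w y z : 'rV[R]_4,
    biform (g x) (Rhat (wedge v w)) (wedge y z) = - curvature g x v w y z.

Definition S_operator (star Rhat : bivector R -> bivector R)
    (xi : bivector R) : bivector R :=
  2^-1 *: (Rhat xi - star (Rhat (star xi))).

(* On unit planes for gL, biform gL P P is the sign epsilon_L(P). *)
Definition sec_LS (gL : 'M[R]_4) (S : bivector R -> bivector R)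
    (P : bivector R) : R :=
  biform gL P P * biform gL (S P) P.

End Lorentz.

(* Main.v *)
From HB Require Import structures.
Require Import Defs.
From mathcomp Require Import all_boot all_order all_algebra.
From mathcomp Require Import all_classical all_reals all_analysis.
From mathcomp Require Import perm complex ring lra.

(** Complete T to an oriented g-orthonormal frame e_0 = T, e_1, e_2, e_3 at p,
    and attach to the bivector with frame components p_ij the vector z of C^3
    with entries p_01 - i p_23, p_02 + i p_13 and p_03 - i p_12. In these
    coordinates the Lorentzian star is the multiplication by i
    ([hodge_star_fvec]). The bilinear product z.w of C^3 encodes at once the
    inner product of g_L and the wedge product, as minus its real part and, up
    to a positive factor, minus its imaginary part ([biform_lorentz],
    [wedge22_cdot]), so a bivector is decomposable iff z.z is real. The inner
    product of g is the real part of the Hermitian product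
    ([biform_riemann]).

    The operator R^ is g-selfadjoint, which is the pair symmetry of the
    curvature tensor, and the star is g-antiselfadjoint; therefore S is
    g-selfadjoint. As S commutes with the star, it is in the coordinates z a
    Hermitian matrix.

    (a) The star multiplies z by i: it changes the sign of z.z, hence the sign
    of g_L on bivectors, and it commutes with S, so that the two factors of
    the sectional curvature both change sign.

    (b) A Hermitian matrix is diagonalizable ([selfadjoint_diagonalizable]).
    So there always are three independent eigenvectors: the diagonal normal
    form always holds, and the Types II and III are excluded
    ([selfadjoint_type_I]).

    (c) In general S is not selfadjoint for g_L. But if P contains T or is
    orthogonal to T then its z is real or purely imaginary, and the forms g_L
    and g agree against P up to one sign: g_L(V, P) = - e g(V, P) for all V,
    where e is 1 or -1. Let V be the velocity at P of a curve of unit planes,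
    and S P = a P + b star P. Selfadjointness of S for g gives
    g_L(S V, P) = a g_L(V, P) - b g_L(V, star P), while
    g_L(S P, V) = a g_L(P, V) + b g_L(star P, V). The terms in b cancel, and
    the derivative of the sectional curvature is 2 a g_L(V, P) up to sign. It
    vanishes, since g_L(P, P) is 1 or -1 along the curve
    ([eigenplane_critical]).

    The pair symmetry is obtained in coordinates: with the Christoffel symbols
    of the first kind, R_abcd splits into second derivatives of the metric and
    products of Christoffel symbols, and both parts are symmetric once the
    partial derivatives commute ([curvature_coord_pair_sym]). That they
    commute for C^2 functions is proved by writing the second difference of
    the function as either mixed derivative at a nearby point
    ([mixed_derive_comm]). *)

Set Implicit Arguments.
Unset Strict Implicit.
Unset Printing Implicit Defensive.

Import Order.TTheory GRing.Theory Num.Theory.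
Import numFieldNormedType.Exports.

Local Open Scope classical_set_scope.
Local Open Scope ring_scope.

(** * Symmetry of mixed directional derivatives *)

Section MixedPartials.
Variables (R : realType) (V : normedModType R).
Implicit Types (f : V -> R) (u v x : V).

Lemma is_derive_line f x u (t : R) : derivable f (x + t *: u) u ->
  is_derive t 1 (fun s : R => f (x + s *: u)) ('D_u f (x + t *: u)).
Proof.
rewrite /derivable /derive => dfu.
have E : (fun h : R => h^-1 *: (f (h *: u + (x + t *: u)) - f (x + t *: u))) =
  (fun h : R => h^-1 *: (((fun s : R => f (x + s *: u)) \o shift t) (h *: 1)
                         - f (x + t *: u))).
  apply/funext => h /=; rewrite [_%:A]mulr1 scalerDl addrCA.
  by rewrite [h *: u + _]addrC !addrA.
by apply: DeriveDef; rewrite /derivable /derive -E.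
Qed.

Lemma mean_value (F dF : R -> R) (h : R) : 0 < h ->
  (forall s, 0 <= s <= h -> is_derive s 1 F (dF s)) ->
  exists2 s, 0 <= s <= h & F h - F 0 = dF s * h.
Proof.
move=> h0 FdF.
have [||s] := @MVT_segment R F dF 0 h (ltW h0).
- by move=> s; rewrite in_itv /= => /andP[s0 sh]; apply: FdF; rewrite !ltW.
- apply: derivable_within_continuous => s; rewrite in_itv /= => sh.
  exact: (@ex_derive _ _ _ _ _ _ _ (FdF s sh)).
- by rewrite in_itv /= subr0 => sh Fs; exists s.
Qed.

(** Two applications of the mean value theorem, first in the direction u to the
    difference of f along v, then in the direction v. The left-hand side does
    not change when u and v are exchanged. *)
Lemma second_difference f x u v (h : R) : 0 < h ->
  (forall s r, 0 <= s <= h -> 0 <= r <= h ->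
     derivable f (x + s *: u + r *: v) u /\
     derivable ('D_u f) (x + s *: u + r *: v) v) ->
  exists s r, [/\ 0 <= s <= h, 0 <= r <= h &
    f (x + h *: u + h *: v) - f (x + h *: u) - f (x + h *: v) + f x =
    h ^+ 2 * 'D_v ('D_u f) (x + s *: u + r *: v)].
Proof.
move=> h0 df.
have hh : 0 <= h <= h by rewrite lexx ltW.
have h00 : 0 <= (0 : R) <= h by rewrite lexx ltW.
pose F (s : R) := f (x + h *: v + s *: u) - f (x + s *: u).
have dF s : 0 <= s <= h ->
    is_derive s 1 F ('D_u f (x + h *: v + s *: u) - 'D_u f (x + s *: u)).
  move=> sh; apply: is_deriveB; apply: is_derive_line.
    by rewrite addrAC; exact: (df _ _ sh hh).1.
  by have := (df _ _ sh h00).1; rewrite scale0r addr0.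
have [s sh Fs] := mean_value h0 dF.
pose G (r : R) := 'D_u f (x + s *: u + r *: v).
have dG r : 0 <= r <= h -> is_derive r 1 G ('D_v ('D_u f) (x + s *: u + r *: v)).
  by move=> rh; apply: is_derive_line; exact: (df _ _ sh rh).2.
have [r rh Gr] := mean_value h0 dG.
exists s, r; split => //.
set D := 'D_v _ _ in Gr *.
rewrite (_ : h ^+ 2 * D = D * h * h); last by ring.
rewrite -Gr /G scale0r addr0 [x + s *: u + h *: v]addrAC -Fs /F.
by rewrite scale0r !addr0 [x + h *: v + _]addrAC; ring.
Qed.

(** The intermediate point supplied by [second_difference] is at distance at
    most h (|u| + |v|) from x, so the continuity of the mixed derivative
    at x suffices. *)
Lemma second_difference_cvg f x u v :
  (\forall y \near x, derivable f y u /\ derivable ('D_u f) y v) ->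
  {for x, continuous ('D_v ('D_u f))} ->
  h ^- 2 * (f (x + h *: u + h *: v) - f (x + h *: u) - f (x + h *: v) + f x)
    @[h --> (0:R)^'+] --> 'D_v ('D_u f) x.
Proof.
move=> df cf; apply/cvgrPdist_lt => e e0.
have /cvgrPdist_lt/(_ e e0) ce := cf.
have /nbhs_ballP[d /= d0 dP] : nbhs x [set y |
    (derivable f y u /\ derivable ('D_u f) y v) /\
    `|'D_v ('D_u f) x - 'D_v ('D_u f) y| < e].
  exact: filterI.
have uv0 : 0 < `|u| + `|v| + 1 by rewrite ltr_wpDl // addr_ge0.
have small h s r : 0 < h -> h < d / (`|u| + `|v| + 1) ->
    0 <= s <= h -> 0 <= r <= h ->
    ball x d (x + s *: u + r *: v).
  move=> h0 hd /andP[s0 sh] /andP[r0 rh].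
  rewrite -ball_normE /= -addrA opprD addrA subrr add0r normrN.
  apply: (le_lt_trans (ler_normD _ _)); rewrite !normrZ !ger0_norm //.
  rewrite ltr_pdivlMr // in hd; apply: le_lt_trans hd.
  apply: (@le_trans _ _ (h * `|u| + h * `|v|)).
    by apply: lerD; rewrite ler_wpM2r.
  by rewrite !mulrDr mulr1 lerDl ltW.
near=> h.
have h0 : 0 < h by near: h; exact: nbhs_right_gt.
have hd : h < d / (`|u| + `|v| + 1).
  by near: h; apply: nbhs_right_lt; rewrite divr_gt0.
have [|s [r [sh rh ->]]] := @second_difference f x u v h h0.
  by move=> s r sh rh; apply: (dP _ (small _ _ _ h0 hd sh rh)).1.
rewrite mulKf ?expf_neq0 ?gt_eqF //.
exact: (dP _ (small _ _ _ h0 hd sh rh)).2.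
Unshelve. all: by end_near. Qed.

(** Schwarz: both mixed derivatives are the limit of the same second
    difference quotient. *)
Lemma mixed_derive_comm f x u v :
  (\forall y \near x, [/\ derivable f y u, derivable f y v,
     derivable ('D_u f) y v & derivable ('D_v f) y u]) ->
  {for x, continuous ('D_v ('D_u f))} ->
  {for x, continuous ('D_u ('D_v f))} ->
  'D_v ('D_u f) x = 'D_u ('D_v f) x.
Proof.
move=> df cuv cvu.
have duv : \forall y \near x, derivable f y u /\ derivable ('D_u f) y v.
  by apply: filterS df => y [].
have dvu : \forall y \near x, derivable f y v /\ derivable ('D_v f) y u.
  by apply: filterS df => y [].
have Huv := second_difference_cvg duv cuv.
have Hvu := second_difference_cvg dvu cvu.
have E : (fun h : R => h ^- 2 *
      (f (x + h *: u + h *: v) - f (x + h *: u) - f (x + h *: v) + f x)) =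
    (fun h : R => h ^- 2 *
      (f (x + h *: v + h *: u) - f (x + h *: v) - f (x + h *: u) + f x)).
  by apply/funext => h; rewrite [x + h *: u + _]addrAC; congr (_ * _); ring.
rewrite E in Huv.
exact: (cvg_unique _ Huv Hvu).
Qed.

End MixedPartials.

(** * Pair symmetry of the curvature tensor *)

Section DerivableBigops.
Variables (R : realType) (V : normedModType R).
Implicit Types (x v : V).

Lemma derivable_bigsum (I : Type) (r : seq I) (P : pred I) (F : I -> V -> R)
    x v :
  (forall i, derivable (F i) x v) ->
  derivable (fun y => \sum_(i <- r | P i) F i y) x v.
Proof.
move=> dF; elim: r => [|i r IH].
  by under eq_fun do rewrite big_nil; exact: derivable_cst.
under eq_fun do rewrite big_cons.
by case: (P i); [exact: (derivableD (dF i) IH)|exact: IH].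
Qed.

Lemma derivable_bigprod (I : Type) (r : seq I) (P : pred I) (F : I -> V -> R)
    x v :
  (forall i, derivable (F i) x v) ->
  derivable (fun y => \prod_(i <- r | P i) F i y) x v.
Proof.
move=> dF; elim: r => [|i r IH].
  by under eq_fun do rewrite big_nil; exact: derivable_cst.
under eq_fun do rewrite big_cons.
by case: (P i); [exact: (derivableM (dF i) IH)|exact: IH].
Qed.

Lemma derive_bigsum n (F : 'I_n -> V -> R) x v :
  (forall i, derivable (F i) x v) ->
  'D_v (fun y => \sum_(i < n) F i y) x = \sum_(i < n) 'D_v (F i) x.
Proof.
move=> dF; rewrite -derive_sum //; congr ('D_v _ x).
by apply/funext => y; rewrite fct_sumE.
Qed.

Lemma derivable_det n (A : V -> 'M[R]_n) x v :
  (forall i j, derivable (fun y => A y i j) x v) ->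
  derivable (fun y => \det (A y)) x v.
Proof.
move=> dA; apply: derivable_bigsum => s.
by apply: derivableM; [exact: derivable_cst|exact: derivable_bigprod].
Qed.

(** Cramer: the entries of the inverse are quotients of polynomials in the
    entries of the matrix. *)
Lemma derivable_invmx n (A : V -> 'M[R]_n) x v :
  (forall i j, derivable (fun y => A y i j) x v) ->
  (\forall y \near x, A y \in unitmx) ->
  forall i j, derivable (fun y => invmx (A y) i j) x v.
Proof.
move=> dA uA i j.
apply: (@near_eq_derivable _ _ _
  (fun y => (\det (A y))^-1 * ((-1) ^+ (j + i) * \det (row' j (col' i (A y)))))).
  apply: filterS uA => y uy.
  by rewrite /invmx uy !mxE.
apply: derivableM.
  apply: derivableV; last exact: derivable_det.
  by rewrite -unitfE; exact: (nbhs_singleton uA).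
apply: derivableM; first exact: derivable_cst.
apply: derivable_det => k l.
by under eq_fun do rewrite !mxE; exact: dA.
Qed.

End DerivableBigops.

Section SmoothPartials.
Variables (R : realType) (U : set 'rV[R]_4) (f : 'rV[R]_4 -> R).
Hypothesis sf : smooth U f.

Lemma smooth_derivable i x : U x -> derivable f x (coord_vec R i).
Proof. by have [_ /(_ i)[d _]] := sf 1; apply: d. Qed.

Lemma smooth_derivable2 i j x : U x ->
  derivable (partial j f) x (coord_vec R i).
Proof. by have [_ /(_ j)[_ [_ /(_ i)[d _]]]] := sf 2; apply: d. Qed.

Lemma smooth_partialC i j x : open U -> U x ->
  partial i (partial j f) x = partial j (partial i f) x.
Proof.
move=> oU Ux; apply: mixed_derive_comm.
- have := open_nbhs_nbhs (conj oU Ux); apply: filterS => y Uy.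
  by split; [exact: smooth_derivable|exact: smooth_derivable|
             exact: smooth_derivable2|exact: smooth_derivable2].
- by have [_ /(_ j)[_ [_ /(_ i)[_ [c _]]]]] := sf 2; exact: c.
- by have [_ /(_ i)[_ [_ /(_ j)[_ [c _]]]]] := sf 2; exact: c.
Qed.

End SmoothPartials.

Section PairSymmetry.
Variables (R : realType) (U : set 'rV[R]_4) (g : 'rV[R]_4 -> 'M[R]_4).
Hypothesis oU : open U.
Hypothesis g_smooth : forall i j, smooth U (fun x => g x i j).
Hypothesis g_sym : forall x, U x -> (g x)^T = g x.
Hypothesis g_unit : forall x, U x -> g x \in unitmx.

(** Christoffel symbols of the first kind. In terms of them curvature has no
    derivative of the inverse metric. *)
Definition christoffel1 (l i j : 'I_4) (x : 'rV[R]_4) : R :=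
  2^-1 * (partial i (fun y => g y j l) x + partial j (fun y => g y i l) x
          - partial l (fun y => g y i j) x).

Lemma christoffelE k i j x :
  christoffel g k i j x = \sum_(l < 4) invmx (g x) k l * christoffel1 l i j x.
Proof.
rewrite /christoffel mulr_sumr; apply: eq_bigr => l _.
by rewrite /christoffel1 mulrCA.
Qed.

Lemma lower_christoffel d b c x : U x ->
  \sum_(k < 4) g x d k * christoffel g k b c x = christoffel1 d b c x.
Proof.
move=> Ux; under eq_bigr do rewrite christoffelE mulr_sumr.
rewrite exchange_big /=.
under eq_bigr do (under eq_bigr do rewrite mulrA; rewrite -mulr_suml).
have gV l : \sum_(k < 4) g x d k * invmx (g x) k l = (d == l)%:R.
  by have /matrixP/(_ d l) := mulmxV (g_unit Ux); rewrite !mxE.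
under eq_bigr do rewrite gV.
by rewrite (bigD1 d) //= eqxx mul1r big1 ?addr0 // => l /negPf;
  rewrite eq_sym => ->; rewrite mul0r.
Qed.

Lemma near_U x : U x -> \forall y \near x, U y.
Proof. by move=> Ux; exact: open_nbhs_nbhs. Qed.

Lemma metric_entryC x i j : U x -> g x i j = g x j i.
Proof. by move=> Ux; rewrite -[in LHS]g_sym // mxE. Qed.

Lemma partial_metricC k i j x : U x ->
  partial k (fun y => g y i j) x = partial k (fun y => g y j i) x.
Proof.
move=> Ux; apply: near_eq_derive; apply: filterS (near_U Ux) => y Uy.
exact: metric_entryC.
Qed.

Lemma partial2_metricC k l i j x : U x ->
  partial k (partial l (fun y => g y i j)) x =
  partial k (partial l (fun y => g y j i)) x.
Proof.
move=> Ux; apply: near_eq_derive; apply: filterS (near_U Ux) => y Uy.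
exact: partial_metricC.
Qed.

(** In the sum of the two symbols the derivatives of g_ak and g_ad cancel, and
    the derivative of g_dk occurs twice, once as that of g_kd. *)
Lemma metric_compatible a d k x : U x ->
  partial a (fun y => g y d k) x = christoffel1 d a k x + christoffel1 k a d x.
Proof.
move=> Ux; rewrite /christoffel1 (partial_metricC a k d) //.
by field.
Qed.

Lemma derivable_christoffel1 i d b c x : U x ->
  derivable (christoffel1 d b c) x (coord_vec R i).
Proof.
move=> Ux; apply: derivableM; first exact: derivable_cst.
by apply: derivableB; [apply: derivableD|]; apply: smooth_derivable2 Ux.
Qed.

Lemma derivable_christoffel i k b c x : U x ->
  derivable (christoffel g k b c) x (coord_vec R i).
Proof.
move=> Ux.
rewrite (_ : christoffel g k b c = fun y =>
  \sum_(l < 4) invmx (g y) k l * christoffel1 l b c y); last first.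
  by apply/funext => y; rewrite christoffelE.
apply: derivable_bigsum => l; apply: derivableM.
  apply: derivable_invmx => [m n|]; first exact: smooth_derivable Ux.
  by apply: filterS (near_U Ux).
exact: derivable_christoffel1.
Qed.

(** The inner product of nabla_a d_d and nabla_b d_c, where d_i is the i-th
    coordinate field. *)
Definition christoffel_form (a d b c : 'I_4) (x : 'rV[R]_4) : R :=
  \sum_(k < 4) christoffel1 k a d x * christoffel g k b c x.

Lemma christoffel_formC a d b c x : U x ->
  christoffel_form a d b c x = christoffel_form b c a d x.
Proof.
move=> Ux; rewrite /christoffel_form.
under eq_bigr do rewrite christoffelE mulr_sumr.
under [RHS]eq_bigr do rewrite christoffelE mulr_sumr.
rewrite exchange_big /=; apply: eq_bigr => l _; apply: eq_bigr => k _.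
have -> : invmx (g x) l k = invmx (g x) k l.
  by rewrite -[in LHS](g_sym Ux) -trmx_inv mxE.
by ring.
Qed.

Lemma christoffel1C l i j x : U x ->
  christoffel1 l i j x = christoffel1 l j i x.
Proof.
move=> Ux; rewrite /christoffel1 (partial_metricC l i j Ux).
by rewrite [partial i _ _ + _]addrC.
Qed.

Lemma christoffel_form_sym a d b c x : U x ->
  christoffel_form a d b c x = christoffel_form d a c b x.
Proof.
move=> Ux; apply: eq_bigr => k _; rewrite (christoffel1C _ _ _ Ux); congr (_ * _).
by rewrite !christoffelE; apply: eq_bigr => l _; rewrite (christoffel1C _ _ _ Ux).
Qed.

(** Leibniz rule on g_dk Gamma^k_bc = Gamma_dbc: the derivative of the metric
    turns into Christoffel symbols by [metric_compatible], and one of the two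
    resulting terms cancels the quadratic term on the left. *)
Lemma lower_nabla2 a b c d x : U x ->
  \sum_(k < 4) (partial a (christoffel g k b c) x +
     \sum_(m < 4) christoffel g m b c x * christoffel g k a m x) * g x k d =
  partial a (christoffel1 d b c) x - christoffel_form a d b c x.
Proof.
move=> Ux.
have Dlow : partial a (christoffel1 d b c) x =
    \sum_(k < 4) (g x d k * partial a (christoffel g k b c) x +
      christoffel g k b c x * partial a (fun y => g y d k) x).
  transitivity ('D_(coord_vec R a)
      (fun y => \sum_(k < 4) g y d k * christoffel g k b c y) x).
    apply: near_eq_derive; apply: filterS (near_U Ux) => y Uy.
    by rewrite lower_christoffel.
  have dg k : derivable (fun y => g y d k) x (coord_vec R a).
    exact: smooth_derivable Ux.
  have dG k : derivable (christoffel g k b c) x (coord_vec R a).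
    exact: derivable_christoffel Ux.
  rewrite derive_bigsum => [|k]; last exact: derivableM (dg k) (dG k).
  by apply: eq_bigr => k _; rewrite deriveM.
have QE : \sum_(k < 4) (\sum_(m < 4)
      christoffel g m b c x * christoffel g k a m x) * g x k d =
    \sum_(m < 4) christoffel g m b c x * christoffel1 d a m x.
  under eq_bigr do rewrite mulr_suml.
  rewrite exchange_big /=; apply: eq_bigr => m _.
  rewrite -lower_christoffel // mulr_sumr; apply: eq_bigr => k _.
  by rewrite (metric_entryC k d) //; ring.
under eq_bigr do rewrite mulrDl.
rewrite big_split /= QE Dlow -sumrB -big_split /=; apply: eq_bigr => k _.
by rewrite (metric_entryC k d) // metric_compatible //; ring.
Qed.

Lemma nabla_coord b c x k :
  nabla g (fun=> coord_vec R b) (fun=> coord_vec R c) x 0 k =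
  christoffel g k b c x.
Proof.
rewrite mxE derive_cst add0r (bigD1 b) //= (bigD1 c) //= !mxE !eqxx !mul1r.
rewrite big1 => [|j /negPf jc]; last by rewrite !mxE jc !(mulr0, mul0r).
rewrite addr0 big1 ?addr0 // => i /negPf ib; apply: big1 => j _.
by rewrite !mxE ib !mul0r.
Qed.

Lemma nabla_nabla_coord a b c x k :
  nabla g (fun=> coord_vec R a)
    (nabla g (fun=> coord_vec R b) (fun=> coord_vec R c)) x 0 k =
  partial a (christoffel g k b c) x +
    \sum_(m < 4) christoffel g m b c x * christoffel g k a m x.
Proof.
rewrite mxE; congr (_ + _).
  rewrite /partial; set F := (X in 'D__ X x = _).
  suff -> : F = christoffel g k b c by [].
  by apply/funext => y; rewrite /F nabla_coord.
rewrite (bigD1 a) //= [X in _ + X]big1 ?addr0 => [|i /negPf ia]; last first.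
  by apply: big1 => j _; rewrite !mxE ia !mul0r.
by apply: eq_bigr => j _; rewrite nabla_coord !mxE !eqxx mul1r.
Qed.

Lemma nabla_bracket_coord a b c x :
  nabla g (lie_bracket (fun=> coord_vec R a) (fun=> coord_vec R b))
    (fun=> coord_vec R c) x = 0.
Proof.
have -> : lie_bracket (fun=> coord_vec R a) (fun=> coord_vec R b) = fun=> 0.
  by apply/funext => y; apply/rowP => k; rewrite !mxE !derive_cst subr0.
apply/rowP => k; rewrite !mxE derive_cst add0r big1 // => i _.
by apply: big1 => j _; rewrite !mxE !mul0r.
Qed.

(** Once its index is lowered, the curvature consists of derivatives of symbols
    of the first kind and of products of symbols, two parts whose symmetries
    can be studied separately. *)
Lemma curvature_coordE a b c d x : U x ->
  curvature g x (coord_vec R a) (coord_vec R b) (coord_vec R c) (coord_vec R d)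
  = partial a (christoffel1 d b c) x - christoffel_form a d b c x
    - (partial b (christoffel1 d a c) x - christoffel_form b d a c x).
Proof.
move=> Ux; rewrite /curvature /curvature_fields nabla_bracket_coord subr0.
have inner_coord (N : 'rV[R]_4) :
    inner (g x) N (coord_vec R d) = \sum_(k < 4) N 0 k * g x k d.
  rewrite /inner mxE (bigD1 d) //= big1 ?addr0 => [|j /negPf jd]; last first.
    by rewrite !mxE jd andbF mulr0.
  by rewrite !mxE !eqxx mulr1.
have subE (A B : 'rV[R]_4) k : (A - B) 0 k = A 0 k - B 0 k by rewrite !mxE.
have := congr2 (fun s t => s - t) (lower_nabla2 a b c d Ux)
  (lower_nabla2 b a c d Ux).
move=> <-; rewrite inner_coord -sumrB; apply: eq_bigr => k _.
by rewrite subE (nabla_nabla_coord a b) (nabla_nabla_coord b a) mulrBl.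
Qed.

Lemma partial_christoffel1 a d b c x : U x ->
  partial a (christoffel1 d b c) x =
  2^-1 * (partial a (partial b (fun y => g y c d)) x
          + partial a (partial c (fun y => g y b d)) x
          - partial a (partial d (fun y => g y b c)) x).
Proof.
move=> Ux.
have dg i j k : derivable (partial i (fun y => g y j k)) x (coord_vec R a).
  exact: smooth_derivable2 Ux.
pose p1 := partial b (fun y => g y c d).
pose p2 := partial c (fun y => g y b d).
pose p3 := partial d (fun y => g y b c).
rewrite /partial -/(p1) -/(p2) -/(p3).
transitivity ('D_(coord_vec R a) (2^-1 \*o (p1 + p2 - p3)) x); first by [].
have d12 := derivableD (dg b c d) (dg c b d).
rewrite deriveMl; last exact: derivableB d12 (dg d b c).
by rewrite (deriveB d12 (dg d b c)) (deriveD (dg b c d) (dg c b d)).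
Qed.

(** By [curvature_coordE] the quadratic part is symmetric since the Christoffel
    symbols and the metric are; in the linear part, the second derivatives of
    g_cd cancel by the symmetry of mixed partial derivatives, and the four that
    remain are permuted. *)
Lemma curvature_coord_pair_sym a b c d x : U x ->
  curvature g x (coord_vec R a) (coord_vec R b) (coord_vec R c) (coord_vec R d)
  = curvature g x (coord_vec R c) (coord_vec R d) (coord_vec R a)
      (coord_vec R b).
Proof.
move=> Ux.
have [Q [QE QC QS]] : exists Q : 'I_4 -> 'I_4 -> 'I_4 -> 'I_4 -> R,
    [/\ forall i j k l, christoffel_form i j k l x = Q i j k l,
        forall i j k l, Q i j k l = Q k l i j
      & forall i j k l, Q i j k l = Q j i l k].
  exists (fun i j k l => christoffel_form i j k l x).
  split=> i j k l; first by reflexivity.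
    exact: (christoffel_formC i j k l Ux).
  exact: (christoffel_form_sym i j k l Ux).
have [h [hE hC hS]] : exists h : 'I_4 -> 'I_4 -> 'I_4 -> 'I_4 -> R,
    [/\ forall i j k l, partial i (partial j (fun y => g y k l)) x = h i j k l,
        forall i j k l, h i j k l = h j i k l
      & forall i j k l, h i j k l = h i j l k].
  exists (fun i j k l => partial i (partial j (fun y => g y k l)) x).
  split=> i j k l; first by reflexivity.
    exact: (smooth_partialC (g_smooth k l) i j oU Ux).
  exact: (partial2_metricC i j k l Ux).
rewrite (curvature_coordE a b c d Ux) (curvature_coordE c d a b Ux).
rewrite (partial_christoffel1 a d b c Ux) (partial_christoffel1 b d a c Ux).
rewrite (partial_christoffel1 c b d a Ux) (partial_christoffel1 d b c a Ux).
rewrite !hE !QE (QC a d b c) (QS b c a d) (QS b d a c) (QC d b c a).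
rewrite (hC b a c d) (hC d c a b) (hC c a d b) (hS a c d b) (hC c b d a).
rewrite (hS b c d a) (hC d a c b) (hS a d c b) (hC d b c a) (hS b d c a).
by ring.
Qed.

End PairSymmetry.

(** * Indices below 3 and 4, and determinants of order 4 *)

Section OrdinalCases.

Lemma big_ord4 (A : nmodType) (F : 'I_4 -> A) :
  \sum_(i < 4) F i = F 0 + F 1 + F 2%:R + F 3%:R.
Proof.
rewrite !big_ord_recl big_ord0 addr0 !addrA.
by congr (_ + _ + _ + _); congr F; apply: val_inj.
Qed.

Lemma big_ord3 (A : nmodType) (F : 'I_3 -> A) :
  \sum_(i < 3) F i = F 0 + F 1 + F 2%:R.
Proof.
rewrite !big_ord_recl big_ord0 addr0 !addrA.
by congr (_ + _ + _); congr F; apply: val_inj.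
Qed.

Lemma ord4P (P : 'I_4 -> Prop) : P 0 -> P 1 -> P 2%:R -> P 3%:R -> forall i, P i.
Proof.
move=> P0 P1 P2 P3 [[|[|[|[|//]]]] lti].
- by rewrite (_ : Ordinal _ = 0) //; apply: val_inj.
- by rewrite (_ : Ordinal _ = 1) //; apply: val_inj.
- by rewrite (_ : Ordinal _ = 2%:R) //; apply: val_inj.
- by rewrite (_ : Ordinal _ = 3%:R) //; apply: val_inj.
Qed.

Lemma ord3P (P : 'I_3 -> Prop) : P 0 -> P 1 -> P 2%:R -> forall i, P i.
Proof.
move=> P0 P1 P2 [[|[|[|//]]] lti].
- by rewrite (_ : Ordinal _ = 0) //; apply: val_inj.
- by rewrite (_ : Ordinal _ = 1) //; apply: val_inj.
- by rewrite (_ : Ordinal _ = 2%:R) //; apply: val_inj.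
Qed.

Lemma det2 (C : comPzRingType) (A : 'M[C]_2) :
  \det A = A 0 0 * A 1 1 - A 0 1 * A 1 0.
Proof.
pose f (i j : nat) := A (inord i) (inord j).
have Af i j : A i j = f i j by rewrite /f !inord_val.
rewrite (expand_det_row _ 0) !big_ord_recl big_ord0 /cofactor !det_mx11 !mxE !Af.
by rewrite /= /bump /=; ring.
Qed.

(** Laplace expansion along the first two rows, that is, the pairing of two
    bivectors. *)
Lemma det4 (C : comPzRingType) (A : 'M[C]_4) :
  let a i j := A i j in
  \det A =
  (a 0 0 * a 1 1 - a 0 1 * a 1 0) *
    (a 2%:R 2%:R * a 3%:R 3%:R - a 2%:R 3%:R * a 3%:R 2%:R)
  - (a 0 0 * a 1 2%:R - a 0 2%:R * a 1 0) *
    (a 2%:R 1 * a 3%:R 3%:R - a 2%:R 3%:R * a 3%:R 1)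
  + (a 0 0 * a 1 3%:R - a 0 3%:R * a 1 0) *
    (a 2%:R 1 * a 3%:R 2%:R - a 2%:R 2%:R * a 3%:R 1)
  + (a 0 1 * a 1 2%:R - a 0 2%:R * a 1 1) *
    (a 2%:R 0 * a 3%:R 3%:R - a 2%:R 3%:R * a 3%:R 0)
  - (a 0 1 * a 1 3%:R - a 0 3%:R * a 1 1) *
    (a 2%:R 0 * a 3%:R 2%:R - a 2%:R 2%:R * a 3%:R 0)
  + (a 0 2%:R * a 1 3%:R - a 0 3%:R * a 1 2%:R) *
    (a 2%:R 0 * a 3%:R 1 - a 2%:R 1 * a 3%:R 0).
Proof.
move=> a; rewrite {}/a.
pose f (i j : nat) := A (inord i) (inord j).
have Af i j : A i j = f i j by rewrite /f !inord_val.
rewrite (expand_det_row _ 0) big_ord4 /cofactor !(expand_det_row _ 0) !big_ord3.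
rewrite /cofactor !det2 !mxE !Af /bump /=.
move: (f 0 0)%N (f 0 1)%N (f 0 2)%N (f 0 3)%N (f 1 0)%N (f 1 1)%N (f 1 2)%N
  (f 1 3)%N (f 2 0)%N (f 2 1)%N (f 2 2)%N (f 2 3)%N (f 3 0)%N (f 3 1)%N
  (f 3 2)%N (f 3 3)%N => *.
by ring.
Qed.

End OrdinalCases.

(** * Bivectors of R^4 *)

Section BivectorAlgebra.
Variable R : realType.
Implicit Types (v w : 'rV[R]_4) (m A : 'M[R]_4) (xi zeta P : bivector R).

Lemma bivectorC xi i j : xi j i = - xi i j.
Proof. by have /eqP/matrixP/(_ i j) := bimx_antisym xi; rewrite !mxE. Qed.

Lemma bivector_diag xi i : xi i i = 0.
Proof. by have := bivectorC xi i i; lra. Qed.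

Lemma bivector_eqP xi zeta :
  xi 0 1 = zeta 0 1 -> xi 0 2%:R = zeta 0 2%:R -> xi 0 3%:R = zeta 0 3%:R ->
  xi 1 2%:R = zeta 1 2%:R -> xi 1 3%:R = zeta 1 3%:R ->
  xi 2%:R 3%:R = zeta 2%:R 3%:R -> xi = zeta.
Proof.
move=> e01 e02 e03 e12 e13 e23; apply: val_inj; apply/matrixP.
have C i j : xi i j = zeta i j -> xi j i = zeta j i.
  by move=> h; rewrite (bivectorC xi i j) (bivectorC zeta i j) h.
by do 2 apply: ord4P; rewrite ?bivector_diag //; apply: C.
Qed.

Lemma bivector_linE i j (a : R) xi zeta : (a *: xi + zeta) i j = a * xi i j + zeta i j.
Proof. by rewrite /= !mxE. Qed.

Lemma wedgeE v w i j : wedge v w i j = v 0 i * w 0 j - w 0 i * v 0 j.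
Proof. by rewrite /= !mxE !big_ord1 !mxE. Qed.

(** Each unordered pair of indices occurs twice, hence the factor 1/2. *)
Lemma bivector_sum xi : xi = \sum_(i < 4) \sum_(j < 4)
  (2^-1 * xi i j) *: wedge (coord_vec R i) (coord_vec R j).
Proof.
have valD : {morph (@bimx R) : x y / x + y} by [].
have val_sum (F : 'I_4 -> bivector R) :
    bimx (\sum_(i < 4) F i) = \sum_(i < 4) bimx (F i).
  by rewrite !big_ord4 !valD.
apply: val_inj; rewrite /= val_sum; under eq_bigr do rewrite val_sum.
apply/matrixP => k l; rewrite summxE; under eq_bigr do rewrite summxE.
have E i j : bimx ((2^-1 * xi i j) *: wedge (coord_vec R i) (coord_vec R j)) k l
   = 2^-1 * xi i j * (((k == i) && (l == j))%:R - ((k == j) && (l == i))%:R).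
  rewrite /= !mxE !big_ord1 !mxE !eqxx /= -!natrM !mulnb.
  by rewrite [(k == j) && _]andbC.
under eq_bigr do under eq_bigr do rewrite E mulrBr.
under eq_bigr do rewrite sumrB.
rewrite sumrB (bigD1 k) //= (bigD1 l) //= !eqxx mulr1 big1 => [|j /negPf jl];
  last by rewrite eq_sym jl mulr0.
rewrite addr0 big1 => [|i /negPf ik]; last first.
  by apply: big1 => j _; rewrite eq_sym ik mulr0.
rewrite addr0 (bigD1 l) //= (bigD1 k) //= !eqxx mulr1 big1 => [|j /negPf jl];
  last by rewrite eq_sym jl mulr0.
rewrite addr0 big1 => [|i /negPf ik]; last first.
  by apply: big1 => j _; rewrite [l == i]eq_sym ik andbF mulr0.
by rewrite addr0 [xi l k]bivectorC; field.
Qed.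

Definition bilinear_form (B : bivector R -> bivector R -> R) :=
  (forall xi, scalar (B xi)) /\ (forall zeta, scalar (B^~ zeta)).

Lemma scalar_bivector_sum (f : bivector R -> R) : scalar f -> forall xi,
  f xi = \sum_(i < 4) \sum_(j < 4)
    2^-1 * xi i j * f (wedge (coord_vec R i) (coord_vec R j)).
Proof.
move=> lf xi.
pose h : {scalar bivector R} :=
  HB.pack f (@GRing.isLinear.Build _ _ _ _ f lf).
rewrite {1}[xi]bivector_sum -[f]/(h : _ -> _) linear_sum.
apply: eq_bigr => i _; rewrite linear_sum; apply: eq_bigr => j _.
exact: linearZ.
Qed.

(** Used to extend to all bivectors the identities that are known for wedges of
    vectors. *)
Lemma bilinear_form_ext (B1 B2 : bivector R -> bivector R -> R) :
  bilinear_form B1 -> bilinear_form B2 ->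
  (forall i j k l,
    B1 (wedge (coord_vec R i) (coord_vec R j))
       (wedge (coord_vec R k) (coord_vec R l)) =
    B2 (wedge (coord_vec R i) (coord_vec R j))
       (wedge (coord_vec R k) (coord_vec R l))) ->
  forall xi zeta, B1 xi zeta = B2 xi zeta.
Proof.
move=> [r1 l1] [r2 l2] E xi zeta.
rewrite (scalar_bivector_sum (l1 zeta)) (scalar_bivector_sum (l2 zeta)).
apply: eq_bigr => i _; apply: eq_bigr => j _; congr (_ * _).
rewrite (scalar_bivector_sum (r1 _)) (scalar_bivector_sum (r2 _)).
by apply: eq_bigr => k _; apply: eq_bigr => l _; rewrite E.
Qed.

Lemma biform_bilinear m : bilinear_form (biform m).
Proof.
split=> [xi a z1 z2|zeta a z1 z2]; rewrite /biform mulrCA -mulrDr; congr (_ * _);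
  do 4![rewrite mulr_sumr -big_split; apply: eq_bigr => ? _];
  by rewrite /= !mxE; ring.
Qed.

Lemma wedge22_bilinear : bilinear_form (@wedge22 R).
Proof.
split=> [xi a z1 z2|zeta a z1 z2]; rewrite /wedge22 mulrCA -mulrDr; congr (_ * _);
  rewrite mulr_sumr -big_split; apply: eq_bigr => s _;
  by move: ((-1) ^+ s) => e /=; rewrite !mxE; ring.
Qed.

Lemma wedge22E xi zeta : wedge22 xi zeta =
  xi 0 1 * zeta 2%:R 3%:R - xi 0 2%:R * zeta 1 3%:R + xi 0 3%:R * zeta 1 2%:R
  + xi 1 2%:R * zeta 0 3%:R - xi 1 3%:R * zeta 0 2%:R + xi 2%:R 3%:R * zeta 0 1.
Proof.
move: xi zeta; apply: bilinear_form_ext; first exact: wedge22_bilinear.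
  by split=> [xi a z1 z2|zeta a z1 z2]; rewrite !bivector_linE; ring.
move=> i j k l.
move: (coord_vec R i) (coord_vec R j) (coord_vec R k) (coord_vec R l).
move=> v0 v1 v2 v3.
pose e (n : 'I_4) := nth 0 [:: v0; v1; v2; v3] n.
rewrite (wedge22_wedge e : wedge22 (wedge v0 v1) (wedge v2 v3) = _) !wedgeE.
have rE n n' : (\matrix_i e i) n n' = e n 0 n' by rewrite mxE.
rewrite /frame_det det4 !rE /e /=.
by ring.
Qed.

(** An orthogonal frame gives an orthogonal basis of bivectors. *)
Lemma biform_diag (d : 'rV[R]_4) xi zeta : biform (diag_mx d) xi zeta =
  xi 0 1 * zeta 0 1 * d 0 0 * d 0 1
  + xi 0 2%:R * zeta 0 2%:R * d 0 0 * d 0 2%:R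
  + xi 0 3%:R * zeta 0 3%:R * d 0 0 * d 0 3%:R
  + xi 1 2%:R * zeta 1 2%:R * d 0 1 * d 0 2%:R
  + xi 1 3%:R * zeta 1 3%:R * d 0 1 * d 0 3%:R
  + xi 2%:R 3%:R * zeta 2%:R 3%:R * d 0 2%:R * d 0 3%:R.
Proof.
have -> : biform (diag_mx d) xi zeta = 2^-1 *
    \sum_(i < 4) \sum_(j < 4) xi i j * zeta i j * d 0 i * d 0 j.
  congr (_ * _); apply: eq_bigr => i _; apply: eq_bigr => j _.
  rewrite (bigD1 i) //= [X in _ + X]big1 ?addr0 => [|k /negPf ki]; last first.
    by apply: big1 => l _; rewrite mxE eq_sym ki mulr0 mul0r.
  rewrite (bigD1 j) //= [X in _ + X]big1 ?addr0 => [|l /negPf lj]; last first.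
    by rewrite [diag_mx d j l]mxE eq_sym lj mulr0.
  by rewrite !mxE !eqxx.
rewrite !big_ord4 !bivector_diag.
rewrite !(bivectorC xi 0 _) !(bivectorC zeta 0 _) !(bivectorC xi 1 2%:R).
rewrite !(bivectorC zeta 1 2%:R) !(bivectorC xi 1 3%:R) !(bivectorC zeta 1 3%:R).
rewrite !(bivectorC xi 2%:R 3%:R) !(bivectorC zeta 2%:R 3%:R).
by field.
Qed.

Lemma bicongr_antisym A xi : A^T *m xi *m A \in @antisym_mx R.
Proof.
have /eqP h := bimx_antisym xi.
by apply/eqP; rewrite !trmx_mul trmxK h mulNmx mulmxN mulmxA.
Qed.

(** The map that v |-> v A induces on bivectors, see [bicongr_wedge]. *)
Definition bicongr A xi : bivector R := Bivector (bicongr_antisym A xi).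

Lemma bicongr_linear A : linear (bicongr A).
Proof.
by move=> a xi zeta; apply: val_inj; rewrite /= mulmxDr mulmxDl -scalemxAr -scalemxAl.
Qed.

HB.instance Definition _ A :=
  GRing.isLinear.Build R (bivector R) (bivector R) _ (bicongr A)
    (bicongr_linear A).

Lemma bicongr_wedge A v w : bicongr A (wedge v w) = wedge (v *m A) (w *m A).
Proof.
by apply: val_inj; rewrite /= mulmxBr mulmxBl !trmx_mul !mulmxA.
Qed.

Lemma bicongrM A B xi : bicongr A (bicongr B xi) = bicongr (B *m A) xi.
Proof. by apply: val_inj; rewrite /= trmx_mul !mulmxA. Qed.

Lemma bicongr1 xi : bicongr 1%:M xi = xi.
Proof. by apply: val_inj; rewrite /= trmx1 mulmx1 mul1mx. Qed.

Lemma bilinear_form_comp (B : bivector R -> bivector R -> R)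
    (f h : {linear bivector R -> bivector R}) :
  bilinear_form B -> bilinear_form (fun xi zeta => B (f xi) (h zeta)).
Proof.
by move=> [r l]; split=> [xi a z1 z2|zeta a z1 z2]; rewrite linearP ?r ?l.
Qed.

Lemma biform_bicongr m A xi zeta :
  biform m (bicongr A xi) (bicongr A zeta) = biform (A *m m *m A^T) xi zeta.
Proof.
apply: (@bilinear_form_ext (fun xi zeta => biform m (bicongr A xi) (bicongr A zeta))).
- exact: bilinear_form_comp (biform_bilinear m).
- exact: biform_bilinear.
- move=> i j k l; rewrite !bicongr_wedge !biform_wedge /inner.
  by rewrite !trmx_mul !mulmxA.
Qed.

(** On wedges of vectors this is the multiplicativity of the determinant. *)
Lemma wedge22_bicongr A xi zeta :
  wedge22 (bicongr A xi) (bicongr A zeta) = \det A * wedge22 xi zeta.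
Proof.
apply: (@bilinear_form_ext (fun xi zeta => wedge22 (bicongr A xi) (bicongr A zeta))
  (fun xi zeta => \det A * wedge22 xi zeta)).
- exact: bilinear_form_comp wedge22_bilinear.
- have [r l] := wedge22_bilinear.
  split=> [xi0 a z1 z2|zeta0 a z1 z2]; first by rewrite r; ring.
  by rewrite l; ring.
move=> i j k l; rewrite !bicongr_wedge.
pose e (n : 'I_4) := nth 0 [:: coord_vec R i; coord_vec R j; coord_vec R k;
  coord_vec R l] n.
rewrite (wedge22_wedge (fun n => e n *m A)) (wedge22_wedge e) /frame_det.
rewrite mulrC -det_mulmx; congr (\det _); apply/row_matrixP => n.
by rewrite row_mul !rowK.
Qed.

(** The condition is the Pluecker relation. If the entry (i, j) of xi is not
    zero, then the relation says that xi is the wedge of its rows i and j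
    divided by that entry. *)
Lemma plucker_decomposable xi : wedge22 xi xi = 0 -> decomposable xi.
Proof.
rewrite wedge22E => pl.
have pl' : xi 0 1 * xi 2%:R 3%:R =
    xi 0 2%:R * xi 1 3%:R - xi 0 3%:R * xi 1 2%:R by lra.
have [z0|/eqP nz] := eqVneq xi 0.
  by exists 0, 0; rewrite z0; apply: bivector_eqP; rewrite wedgeE !mxE mul0r subrr.
pose rel i j k l := xi i k * xi j l - xi j k * xi i l = xi i j * xi k l.
have dec i j : xi i j != 0 -> rel i j 0 1 -> rel i j 0 2%:R -> rel i j 0 3%:R ->
    rel i j 1 2%:R -> rel i j 1 3%:R -> rel i j 2%:R 3%:R -> decomposable xi.
  move=> nij r01 r02 r03 r12 r13 r23.
  exists ((xi i j)^-1 *: row i xi), (row j xi).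
  have rows k l : rel i j k l ->
      xi k l = wedge ((xi i j)^-1 *: row i xi) (row j xi) k l.
    by move=> E; apply: (mulfI nij); rewrite -E wedgeE !mxE; field; exact: nij.
  by apply: bivector_eqP; exact: rows.
have c10 := bivectorC xi 0 1; have c20 := bivectorC xi 0 2%:R.
have c30 := bivectorC xi 0 3%:R; have c21 := bivectorC xi 1 2%:R.
have c31 := bivectorC xi 1 3%:R; have c32 := bivectorC xi 2%:R 3%:R.
have [i [j xij]] : exists i j, xi i j != 0.
  apply: contrapT => h; apply: nz; apply/val_inj/matrixP => i j.
  rewrite [RHS]mxE; apply/eqP/negPn/negP => xij; apply: h.
  by exists i, j.
by move: i j xij; do 2 apply: ord4P; rewrite ?bivector_diag ?eqxx // => nij;
  apply: (dec _ _ nij);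
  rewrite /rel ?bivector_diag ?c10 ?c20 ?c30 ?c21 ?c31 ?c32; ring: pl'.
Qed.

Lemma wedge22_decomposable xi : decomposable xi -> wedge22 xi xi = 0.
Proof. by move=> [v [w ->]]; rewrite wedge22E !wedgeE; ring. Qed.

End BivectorAlgebra.

(** * Frames adapted to the vector T *)

Section OrthonormalFrames.
Variables (R : realType) (m : 'M[R]_4).
Hypothesis m_sym : m^T = m.
Hypothesis m_pos : forall v : 'rV[R]_4, v != 0 -> 0 < (v *m m *m v^T) 0 0.

(** The orthogonality to k < 4 vectors is a system of k linear equations, which
    has a nonzero solution; positivity allows to normalize it. *)
Lemma orthonormal_extend k (A : 'M[R]_(k, 4)) : (k < 4)%N ->
  A *m m *m A^T = 1%:M ->
  exists v : 'rV[R]_4, col_mx A v *m m *m (col_mx A v)^T = 1%:M.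
Proof.
move=> k4 A1.
have : kermx (m *m A^T) != 0.
  rewrite -mxrank_eq0 mxrank_ker subn_eq0 -ltnNge.
  exact: leq_ltn_trans (rank_leq_col _) k4.
case/rowV0Pn => v /sub_kermxP vA v0.
have vv := m_pos v0; set q := (v *m m *m v^T) 0 0 in vv.
exists ((Num.sqrt q)^-1 *: v).
have vA' : v *m m *m A^T = 0 by rewrite -mulmxA.
have Av : A *m m *m v^T = 0.
  by apply: trmx_inj; rewrite trmx0 -vA' !trmx_mul trmxK m_sym mulmxA.
rewrite tr_col_mx mul_col_mx mul_col_row A1 linearZ /= -!scalemxAl.
rewrite -!scalemxAr Av vA' !scaler0 scalar_mx_block; congr block_mx.
rewrite [v *m m *m v^T]mx11_scalar -/q !scale_scalar_mx mulrA -invfM -expr2.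
by rewrite sqr_sqrtr ?ltW // mulVf // gt_eqF.
Qed.

(** If the frame produced by [orthonormal_extend] is negatively oriented, its
    last vector is replaced by the opposite one. *)
Lemma orthonormal_frame (T : 'rV[R]_4) : T *m m *m T^T = 1%:M ->
  exists E : 'M[R]_4, [/\ E *m m *m E^T = 1%:M, row 0 E = T & 0 < \det E].
Proof.
move=> T1.
have [v1 V1] := @orthonormal_extend 1 _ isT T1.
have [v2 V2] := @orthonormal_extend 2 _ isT V1.
have [v3 V3] := @orthonormal_extend 3 _ isT V2.
set A : 'M[R]_4 := col_mx (col_mx (col_mx T v1) v2) v3 in V3.
have A0 : row 0 A = T.
  have <- : row (lshift 1 (lshift 1 (lshift 1 0)))
      (col_mx (col_mx (col_mx T v1) v2) v3) = T by rewrite !rowKu row_id.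
  by congr (row _ _); exact: val_inj.
have detA : \det A != 0.
  apply/eqP => dA; have /(congr1 determinant) := V3.
  rewrite (_ : \det (_ *m _ *m _) = \det A * \det m * \det A^T).
    by rewrite dA !mul0r det1 => /esym/eqP; rewrite oner_eq0.
  by rewrite !det_mulmx.
have [dA|dA|dA] := ltgtP 0 (\det A); first by exists A.
- pose d : 'rV[R]_4 := \row_j (if j == 3%:R then -1 else 1).
  exists (diag_mx d *m A); split.
  + rewrite trmx_mul tr_diag_mx !mulmxA.
    rewrite -(mulmxA _ A m) -(mulmxA _ _ A^T) V3 mulmx1 mulmx_diag.
    rewrite -diag_const_mx; congr diag_mx; apply/rowP => j; rewrite !mxE.
    by case: ifP => _; rewrite ?mulrNN mulr1.
  + apply/rowP => j; rewrite -A0 mul_diag_mx !mxE.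
    by rewrite (_ : (0 == 3%:R :> 'I_4) = false) // mul1r.
  + rewrite det_mulmx det_diag (bigD1 3%:R) //= big1 => [|j /negPf j3].
      by rewrite mxE eqxx mulr1 mulN1r oppr_gt0.
    by rewrite mxE j3.
- by rewrite dA eqxx in detA.
Qed.

End OrthonormalFrames.

Section LorentzFrames.
Variables (R : realType) (g E : 'M[R]_4) (T : 'rV[R]_4).
Hypothesis Eg : E *m g *m E^T = 1%:M.
Hypothesis E0 : row 0 E = T.
Hypothesis detE : 0 < \det E.

Definition minkowski : 'rV[R]_4 := \row_j (if j == 0 then -1 else 1).

Lemma frame_flat : T *m g *m E^T = delta_mx 0 0.
Proof. by rewrite -E0 -!row_mul Eg row1. Qed.

(** T^flat has components (1, 0, 0, 0) in the frame, so subtracting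
    2 T^flat (x) T^flat changes only the sign of the time direction. *)
Lemma frame_lorentz :
  E *m lorentz_metric g T *m E^T = diag_mx minkowski.
Proof.
rewrite /lorentz_metric mulmxBr mulmxBl Eg -scalemxAr -scalemxAl.
have -> : E *m ((T *m g)^T *m (T *m g)) *m E^T =
    (delta_mx 0 0)^T *m (delta_mx 0 0 : 'rV[R]_4).
  by rewrite -frame_flat [(_ *m E^T)^T]trmx_mul trmxK !mulmxA.
rewrite trmx_delta mul_delta_mx; apply/matrixP => i j; rewrite !mxE.
case: (eqVneq i j) => [<-|ij] /=; last first.
  rewrite mulr0n; case: eqP => [i0|_]; case: eqP => [j0|_]; rewrite ?mulr0 ?subr0 //.
  by rewrite i0 j0 eqxx in ij.
by case: eqP => _; rewrite /= ?mulr1 ?mulr0 ?subr0 ?mulr1n //; ring.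
Qed.

Lemma frame_oriented_orthonormal :
  oriented_orthonormal (lorentz_metric g T) (fun i => row i E).
Proof.
have innerE i j : inner (lorentz_metric g T) (row i E) (row j E) =
    diag_mx minkowski i j.
  by rewrite -frame_lorentz /inner -!row_mul !mxE; apply: eq_bigr => k _;
    rewrite !mxE.
split=> [i|i j /negPf ij|]; rewrite ?innerE.
- by rewrite !mxE eqxx mulr1n; case: ifP => _; [right|left].
- by rewrite !mxE ij.
- rewrite /frame_det (_ : \matrix_i row i E = E) //.
  by apply/row_matrixP => i; rewrite rowK.
Qed.

Lemma frame_unit : E \in unitmx.
Proof. by rewrite unitmxE unitfE gt_eqF. Qed.

Lemma biform_frame m xi zeta : biform m xi zeta =
  biform (E *m m *m E^T) (bicongr (invmx E) xi) (bicongr (invmx E) zeta).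
Proof. by rewrite -biform_bicongr !bicongrM mulVmx ?frame_unit // !bicongr1. Qed.

Lemma wedge22_frame xi zeta : wedge22 xi zeta =
  \det E * wedge22 (bicongr (invmx E) xi) (bicongr (invmx E) zeta).
Proof. by rewrite -wedge22_bicongr !bicongrM mulVmx ?frame_unit // !bicongr1. Qed.

End LorentzFrames.

(** * Bivectors as vectors of C^3 *)

Section ComplexCoordinates.
Variable R : realType.
Local Notation C := R[i].
Implicit Types (xi zeta : bivector R) (z w : 'rV[C]_3) (m : 'M[R]_4).

Definition cdot z w : C := \sum_(k < 3) z 0 k * w 0 k.
Definition hdot z w : C := \sum_(k < 3) z 0 k * (w 0 k)^*.

Lemma hdotZ (a : C) z w : hdot (a *: z) w = a * hdot z w.
Proof. by rewrite mulr_sumr; apply: eq_bigr => k _; rewrite mxE mulrA. Qed.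

Lemma hdot_delta z (j : 'I_3) : hdot z (delta_mx 0 j) = z 0 j.
Proof.
rewrite /hdot (bigD1 j) //= mxE !eqxx conjC1 mulr1 big1 ?addr0 // => k /negPf kj.
by rewrite mxE kj andbF conjC0 mulr0.
Qed.

Lemma hdot_deltal w (j : 'I_3) : hdot (delta_mx 0 j) w = (w 0 j)^*.
Proof.
rewrite /hdot (bigD1 j) //= mxE !eqxx mul1r big1 ?addr0 // => k /negPf kj.
by rewrite mxE kj andbF mul0r.
Qed.

(** The signs make the Lorentzian star the multiplication by i: see
    [hodge_star_fvec]. *)
Definition cvec xi : 'rV[C]_3 := \row_k nth 0
  [:: (xi 0 1 +i* - xi 2%:R 3%:R)%C; (xi 0 2%:R +i* xi 1 3%:R)%C;
      (xi 0 3%:R +i* - xi 1 2%:R)%C] k.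

Definition cbiv_upper z : 'M[R]_4 := \matrix_(i, j) nth 0 (nth [::]
  [:: [:: 0; complex.Re (z 0 0); complex.Re (z 0 1); complex.Re (z 0 2%:R)];
      [:: 0; 0; - complex.Im (z 0 2%:R); complex.Im (z 0 1)];
      [:: 0; 0; 0; - complex.Im (z 0 0)]] i) j.

Lemma cbiv_antisym z : cbiv_upper z - (cbiv_upper z)^T \in @antisym_mx R.
Proof. by apply/eqP; rewrite linearB /= trmxK opprB. Qed.

Definition cbiv z : bivector R := Bivector (cbiv_antisym z).

Lemma cvecE xi :
  [/\ cvec xi 0 0 = (xi 0 1 +i* - xi 2%:R 3%:R)%C,
      cvec xi 0 1 = (xi 0 2%:R +i* xi 1 3%:R)%C
    & cvec xi 0 2%:R = (xi 0 3%:R +i* - xi 1 2%:R)%C].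
Proof. by rewrite /cvec; split; rewrite mxE. Qed.

Lemma complex_eq (x y : C) : complex.Re x = complex.Re y ->
  complex.Im x = complex.Im y -> x = y.
Proof. by case: x y => a b [c d] /= -> ->. Qed.

Lemma row3P z w : z 0 0 = w 0 0 -> z 0 1 = w 0 1 -> z 0 2%:R = w 0 2%:R -> z = w.
Proof. by move=> e0 e1 e2; apply/rowP; apply: ord3P. Qed.

Lemma cvecP (a : R) xi zeta :
  cvec (a *: xi + zeta) = (a%:C)%C *: cvec xi + cvec zeta.
Proof.
by apply: row3P; rewrite !mxE; apply: complex_eq; rewrite /= ?mxE; ring.
Qed.

Lemma cbivK : cancel cbiv cvec.
Proof.
move=> z; have [e0 e1 e2] := cvecE (cbiv z).
by apply: row3P; rewrite ?e0 ?e1 ?e2 !mxE; apply: complex_eq;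
  rewrite /= ?subr0 ?opprK.
Qed.

Lemma cvecK : cancel cvec cbiv.
Proof.
move=> xi; have [e0 e1 e2] := cvecE xi.
by apply: bivector_eqP; rewrite !mxE /= ?e0 ?e1 ?e2 /= ?opprK subr0.
Qed.

Lemma cdot_cvec xi zeta : cdot (cvec xi) (cvec zeta) =
  ((- biform (diag_mx (minkowski R)) xi zeta) +i* - wedge22 xi zeta)%C.
Proof.
have [x0 x1 x2] := cvecE xi; have [y0 y1 y2] := cvecE zeta.
rewrite /cdot big_ord3 x0 x1 x2 y0 y1 y2 biform_diag wedge22E !mxE /=.
by apply: complex_eq => /=; ring.
Qed.

Lemma hdot_cvec xi zeta :
  complex.Re (hdot (cvec xi) (cvec zeta)) = biform 1%:M xi zeta.
Proof.
have [x0 x1 x2] := cvecE xi; have [y0 y1 y2] := cvecE zeta.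
rewrite /hdot big_ord3 x0 x1 x2 y0 y1 y2 -diag_const_mx biform_diag !mxE /=.
by ring.
Qed.

End ComplexCoordinates.

Section FrameCoordinates.
Variables (R : realType) (g E : 'M[R]_4) (T : 'rV[R]_4).
Hypothesis Eg : E *m g *m E^T = 1%:M.
Hypothesis E0 : row 0 E = T.
Hypothesis detE : 0 < \det E.
Local Notation gL := (lorentz_metric g T).
Local Notation C := R[i].

(** Coordinates in the frame of the rows of E; [bicongr (invmx E)] gives the
    frame components of a bivector. *)
Definition fvec (xi : bivector R) : 'rV[C]_3 := cvec (bicongr (invmx E) xi).
Definition fbiv (z : 'rV[C]_3) : bivector R := bicongr E (cbiv z).

Lemma fvecP (a : R) xi zeta :
  fvec (a *: xi + zeta) = (a%:C)%C *: fvec xi + fvec zeta.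
Proof. by rewrite /fvec linearP cvecP. Qed.

Lemma fvecK : cancel fvec fbiv.
Proof.
move=> xi; rewrite /fvec /fbiv cvecK bicongrM mulVmx ?bicongr1 //.
exact: frame_unit.
Qed.

Lemma fbivK : cancel fbiv fvec.
Proof.
move=> z; rewrite /fvec /fbiv bicongrM mulmxV ?bicongr1 ?cbivK //.
exact: frame_unit.
Qed.

Lemma biform_lorentz xi zeta :
  biform gL xi zeta = - complex.Re (cdot (fvec xi) (fvec zeta)).
Proof.
by rewrite cdot_cvec /= opprK (biform_frame detE) (frame_lorentz Eg E0).
Qed.

Lemma biform_riemann xi zeta :
  biform g xi zeta = complex.Re (hdot (fvec xi) (fvec zeta)).
Proof. by rewrite hdot_cvec (biform_frame detE) Eg. Qed.

Lemma wedge22_cdot xi zeta :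
  wedge22 xi zeta = - (\det E * complex.Im (cdot (fvec xi) (fvec zeta))).
Proof. by rewrite cdot_cvec /= (wedge22_frame detE) mulrN opprK. Qed.

Lemma cdot_eq0 (d : 'rV[C]_3) :
  (forall z, complex.Im (cdot z d) = 0) -> d = 0.
Proof.
move=> h.
have hk (a : C) k : complex.Im (a * d 0 k) = 0.
  rewrite -[RHS](h (a *: delta_mx 0 k)); congr complex.Im.
  rewrite /cdot (bigD1 k) //= !mxE !eqxx mulr1 big1 ?addr0 // => j /negPf jk.
  by rewrite !mxE jk andbF mulr0 mul0r.
apply/rowP => k; rewrite [RHS]mxE.
have := hk 1 k; have := hk 'i%C k; case: (d 0 k) => x y /=.
rewrite !mul0r !mul1r ?addr0 ?add0r => -> ->.
by [].
Qed.

(** The definition of the star says that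
    Im (z . fvec (star xi)) = Re (z . fvec xi) = Im (z . i fvec xi) for all z,
    and the imaginary part of the bilinear product is nondegenerate. *)
Lemma hodge_star_fvec (star : bivector R -> bivector R) :
  is_hodge_star gL star -> forall xi, fvec (star xi) = 'i%C *: fvec xi.
Proof.
move=> hs xi; apply/eqP; rewrite -subr_eq0; apply/eqP; apply: cdot_eq0 => z.
have := hs _ (frame_oriented_orthonormal Eg E0 detE) (fbiv z) xi.
rewrite wedge22_cdot biform_lorentz fbivK.
rewrite /frame_det (_ : \matrix_i row i E = E); last first.
  by apply/row_matrixP => i; rewrite rowK.
move=> h.
have {}h : complex.Im (cdot z (fvec (star xi))) = complex.Re (cdot z (fvec xi)).
  apply: (mulfI (lt0r_neq0 detE)).
  by apply: oppr_inj; rewrite h mulrC mulrN.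
rewrite (_ : cdot _ _ =
    cdot z (fvec (star xi)) - 'i%C * cdot z (fvec xi)).
  move: h; case: (cdot z (fvec (star xi))) => a b /=.
  by case: (cdot z (fvec xi)) => c d /= ->; ring.
rewrite /cdot mulr_sumr -sumrB; apply: eq_bigr => k _.
by rewrite !mxE; ring.
Qed.

Lemma decomposableP xi :
  decomposable xi <-> complex.Im (cdot (fvec xi) (fvec xi)) = 0.
Proof.
split=> [/wedge22_decomposable/eqP|h].
  by rewrite wedge22_cdot oppr_eq0 mulf_eq0 gt_eqF //= => /eqP.
by apply: plucker_decomposable; rewrite wedge22_cdot h mulr0 oppr0.
Qed.

Lemma fvec_wedge v w : fvec (wedge v w) =
  cvec (wedge (v *m invmx E) (w *m invmx E)).
Proof. by rewrite /fvec bicongr_wedge. Qed.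

Lemma frame_time (u : 'rV[R]_4) : (u *m invmx E) 0 0 = inner g T u.
Proof.
have uE : E \in unitmx by exact: frame_unit.
rewrite /inner -[u in RHS](mulmxKV uE) trmx_mul mulmxA.
rewrite (frame_flat Eg E0); move: (u *m invmx E) => c.
rewrite [RHS]mxE (bigD1 0) //= !mxE eqxx mul1r.
rewrite big1 ?addr0 // => j /negPf j0.
by rewrite !mxE j0 andbF mul0r.
Qed.

(** A plane orthogonal to T has no components p_0k, so its coordinates are
    purely imaginary. *)
Lemma fvec_orthogonal P : decomposable P ->
  (forall u, in_plane P u -> inner g T u = 0) ->
  forall k, (fvec P 0 k)^* = - fvec P 0 k.
Proof.
move=> [v [w PE]] orth.
have v0 : (v *m invmx E) 0 0 = 0.
  rewrite frame_time; apply: orth; exists v, w, 1, 0.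
  by rewrite scale1r scale0r addr0.
have w0 : (w *m invmx E) 0 0 = 0.
  rewrite frame_time; apply: orth; exists v, w, 0, 1.
  by rewrite scale1r scale0r add0r.
rewrite PE fvec_wedge.
have [e0 e1 e2] := cvecE (wedge (v *m invmx E) (w *m invmx E)).
by apply: ord3P; rewrite ?e0 ?e1 ?e2 !wedgeE v0 w0; apply: complex_eq => /=; ring.
Qed.

(** T has no space components, so the space components of two vectors spanning
    a plane through T are proportional: the components p_jk with j, k > 0
    vanish and the coordinates are real. *)
Lemma fvec_containing P : in_plane P T ->
  forall k, (fvec P 0 k)^* = fvec P 0 k.
Proof.
move=> [v [w [s [t [PE TE]]]]].
have TV : T *m invmx E = delta_mx 0 0.
  by rewrite -E0 -row_mul mulmxV ?row1 // frame_unit.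
have st j : s * (v *m invmx E) 0 j + t * (w *m invmx E) 0 j = (j == 0)%:R.
  have /rowP/(_ j) := TV; rewrite TE mulmxDl -!scalemxAl.
  by move: (v *m _) (w *m _) => a b; rewrite !mxE eqxx.
rewrite PE fvec_wedge.
have [e0 e1 e2] := cvecE (wedge (v *m invmx E) (w *m invmx E)).
have sv j : j != 0 -> s * (v *m invmx E) 0 j + t * (w *m invmx E) 0 j = 0.
  by move=> /negPf j0; rewrite st j0.
have st0 : (s != 0) || (t != 0).
  rewrite -negb_and; apply/negP => /andP[/eqP s0 /eqP t0]; have := st 0.
  by rewrite s0 t0 !mul0r addr0 eqxx => /esym/eqP; rewrite oner_eq0.
have spatial j k : j != 0 -> k != 0 ->
    wedge (v *m invmx E) (w *m invmx E) j k = 0.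
  move=> /sv jv /sv kv; rewrite wedgeE.
  move: ((v *m invmx E) 0 j) ((v *m invmx E) 0 k) jv kv => vj vk.
  move: ((w *m invmx E) 0 j) ((w *m invmx E) 0 k) => wj wk jv kv.
  case/orP: st0 => n0; apply: (mulfI n0); rewrite mulr0.
    rewrite (_ : s * _ = (s * vj + t * wj) * wk - wj * (s * vk + t * wk)).
      by rewrite jv kv mul0r mulr0 subrr.
    by ring.
  rewrite (_ : t * _ = vj * (s * vk + t * wk) - (s * vj + t * wj) * vk).
    by rewrite jv kv mul0r mulr0 subrr.
  by ring.
by apply: ord3P; rewrite ?e0 ?e1 ?e2
  ?(spatial 2%:R 3%:R) ?(spatial 1 3%:R) ?(spatial 1 2%:R) //;
  apply: complex_eq => /=; ring.
Qed.

End FrameCoordinates.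

(** * Selfadjoint complex-linear operators on bivectors *)

Section ComplexStructure.
Variables (R : realType) (phi : bivector R -> 'rV[R[i]]_3).
Variables (psi : 'rV[R[i]]_3 -> bivector R) (star : bivector R -> bivector R).
Hypothesis phiP : forall (a : R) xi zeta,
  phi (a *: xi + zeta) = (a%:C)%C *: phi xi + phi zeta.
Hypothesis phiK : cancel phi psi.
Hypothesis psiK : cancel psi phi.
Hypothesis phi_star : forall xi, phi (star xi) = 'i%C *: phi xi.
Local Notation C := R[i].
Local Notation cscale := Defs.cscale.

Lemma phi_inj : injective phi. Proof. exact: can_inj phiK. Qed.

Lemma phi_add xi zeta : phi (xi + zeta) = phi xi + phi zeta.
Proof. by rewrite -[xi]scale1r phiP rmorph1 !scale1r. Qed.

Lemma phi_zero : phi 0 = 0.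
Proof. by apply: (addrI (phi 0)); rewrite -phi_add !addr0. Qed.

Lemma phi_scale (a : R) xi : phi (a *: xi) = (a%:C)%C *: phi xi.
Proof. by rewrite -[a *: xi]addr0 phiP phi_zero addr0. Qed.

Lemma phi_opp xi : phi (- xi) = - phi xi.
Proof. by rewrite -scaleN1r phi_scale rmorphN1 scaleN1r. Qed.

Lemma phi_sum n (F : 'I_n -> bivector R) :
  phi (\sum_(i < n) F i) = \sum_(i < n) phi (F i).
Proof. exact: (big_morph phi phi_add phi_zero). Qed.

Lemma phi_cscale (z : C) xi : phi (cscale star z xi) = z *: phi xi.
Proof.
rewrite /cscale phi_add !phi_scale phi_star scalerA -scalerDl; congr (_ *: _).
by case: z => x y; apply: complex_eq => /=; ring.
Qed.

Lemma star_star xi : star (star xi) = - xi.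
Proof.
by apply: phi_inj; rewrite !phi_star phi_opp scalerA -expr2 sqr_i scaleN1r.
Qed.

Lemma phi_lincomb n (z : 'I_n -> C) (b : 'I_n -> bivector R) :
  phi (\sum_(i < n) cscale star (z i) (b i)) =
  (\row_i z i) *m (\matrix_i phi (b i)).
Proof.
rewrite phi_sum mulmx_sum_row; apply: eq_bigr => i _.
by rewrite phi_cscale rowK mxE.
Qed.

Lemma cindependentP n (b : 'I_n -> bivector R) :
  cindependent star b <-> row_free (\matrix_i phi (b i)).
Proof.
rewrite -kermx_eq0; split=> [ind|/eqP ker0 z z0 i].
  apply/rowV0P => v /sub_kermxP v0; apply/rowP => i; rewrite mxE.
  apply: (ind (fun i => v 0 i)); apply: phi_inj.
  by rewrite phi_lincomb phi_zero -[RHS]v0; congr (_ *m _); apply/rowP => j;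
    rewrite mxE.
have /sub_kermxP : (\row_i z i) *m (\matrix_i phi (b i)) = 0.
  by rewrite -phi_lincomb z0 phi_zero.
by rewrite ker0 submx0 => /eqP/rowP/(_ i); rewrite !mxE.
Qed.

Lemma unitmx_cbasis (B : 'M[C]_3) : B \in unitmx ->
  cbasis star (fun i => psi (row i B)).
Proof.
move=> uB; have BE : \matrix_i phi (psi (row i B)) = B.
  by apply/row_matrixP => i; rewrite rowK psiK.
split=> [|xi]; first by apply/cindependentP; rewrite BE row_free_unit.
exists (fun i => (phi xi *m invmx B) 0 i); apply: phi_inj.
rewrite phi_lincomb BE (_ : \row_i _ = phi xi *m invmx B) ?mulmxKV //.
by apply/rowP => i; rewrite mxE.
Qed.

Lemma no_four_independent (b : 'I_4 -> bivector R) : ~ cindependent star b.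
Proof.
move/cindependentP/eqP => rk.
by have := rank_leq_col (\matrix_i phi (b i)); rewrite rk.
Qed.

Lemma independent_eigenvectors_pred (S : bivector R -> bivector R) n :
  has_independent_eigenvectors star S n.+1 ->
  has_independent_eigenvectors star S n.
Proof.
move=> [b [ind eig]]; exists (fun i => b (widen_ord (leqnSn n) i)).
split=> [z z0 i|i]; last exact: eig.
pose z' (j : 'I_n.+1) := if unlift ord_max j is Some k then z k else 0.
have z'w k : z' (widen_ord (leqnSn n) k) = z k.
  rewrite /z' (_ : widen_ord _ k = lift ord_max k) ?liftK //.
  by apply: val_inj; rewrite /= /bump leqNgt ltn_ord.
rewrite -z'w; apply: ind; rewrite big_ord_recr /=.
rewrite [X in _ + X](_ : _ = 0) ?addr0; last first.
  by apply: phi_inj; rewrite phi_cscale /z' unlift_none scale0r phi_zero.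
by under eq_bigr do rewrite z'w.
Qed.

Section ComplexLinearMap.
Variable S : bivector R -> bivector R.
Hypothesis S_clinear : clinear star S.

Lemma clinear_matrix : {H : 'M[C]_3 | forall xi, phi (S xi) = phi xi *m H}.
Proof.
pose F z := phi (S (psi z)).
have F_linear : linear F.
  move=> a z w; rewrite /F.
  have -> : psi (a *: z + w) = cscale star a (psi z) + psi w.
    by apply: phi_inj; rewrite phi_add phi_cscale !psiK.
  by rewrite S_clinear phi_add phi_cscale.
pose Fl : {linear 'rV[C]_3 -> 'rV[C]_3} :=
  HB.pack F (@GRing.isLinear.Build _ _ _ _ F F_linear).
exists (lin1_mx Fl) => xi.
by rewrite (mul_rV_lin1 Fl) /= /F phiK.
Qed.

Hypothesis S_selfadjoint : forall xi zeta,
  complex.Re (hdot (phi (S xi)) (phi zeta)) =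
  complex.Re (hdot (phi xi) (phi (S zeta))).

(** The equality of real parts for z and for i z gives the equality of the
    complex products, because S is complex-linear. *)
Lemma selfadjoint_matrix_hermitian (H : 'M[C]_3) :
  (forall xi, phi (S xi) = phi xi *m H) -> map_mx Num.conj H^T = H.
Proof.
move=> SH.
have Re_sym z w : complex.Re (hdot (z *m H) w) = complex.Re (hdot z (w *m H)).
  by have := S_selfadjoint (psi z) (psi w); rewrite !SH !psiK.
have sym z w : hdot (z *m H) w = hdot z (w *m H).
  have := Re_sym ('i%C *: z) w; rewrite -scalemxAl !hdotZ.
  move: (Re_sym z w); case: (hdot _ _) => a b; case: (hdot _ _) => c d /= -> E.
  by apply: complex_eq => //=; move: E; rewrite !mul0r !mul1r; lra.
apply/matrixP => i j; rewrite !mxE.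
have := sym (delta_mx 0 i) (delta_mx 0 j); rewrite hdot_delta hdot_deltal.
by rewrite -!rowE !mxE.
Qed.

Lemma selfadjoint_diagonalizable : exists (l : 'I_3 -> C) b,
  cbasis star b /\ forall j, S (b j) = cscale star (l j) (b j).
Proof.
have [H SH] := clinear_matrix.
have Hh := selfadjoint_matrix_hermitian SH.
have nH : H \is normalmx by apply/normalmxP; rewrite Hh.
set P := spectralmx H; set d := spectral_diag H.
have uP : P \in unitmx by exact: spectral_unit.
exists (fun i => d 0 i), (fun i => psi (row i P)).
split=> [|j]; first exact: unitmx_cbasis.
apply: phi_inj; rewrite SH phi_cscale psiK.
have PH : P *m H = diag_mx d *m P.
  by rewrite {1}(orthomx_spectralP nH) !mulmxA mulmxV // mul1mx.
rewrite -row_mul PH; apply/rowP => k.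
by rewrite mul_diag_mx !mxE.
Qed.

Lemma selfadjoint_petrov : exists l1 l2 l3 : C,
  csimilar star S (mx3 [:: [:: l1; 0; 0]; [:: 0; l2; 0]; [:: 0; 0; l3]]).
Proof.
have [l [b [bas Sb]]] := selfadjoint_diagonalizable.
exists (l 0), (l 1), (l 2%:R), b; split=> // j; rewrite Sb big_ord3 !mxE.
have c0 xi : cscale star 0 xi = 0 by rewrite /cscale !scale0r addr0.
by move: j; apply: ord3P; rewrite /= !c0 ?addr0 ?add0r.
Qed.

Lemma selfadjoint_type_I : petrov_type_I star S.
Proof.
have [l [b [[ind span] Sb]]] := selfadjoint_diagonalizable.
split; last by move=> [c [indc _]]; exact: no_four_independent indc.
exists b; split=> // i; split; last by exists (l i).
move=> bi0; have := ind (fun j => (j == i)%:R).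
rewrite (bigD1 i) //= big1 => [|j /negPf ->]; last first.
  by rewrite /cscale !scale0r addr0.
rewrite bi0 addr0 => /(_ _ i); rewrite eqxx => h.
have /eqP : (1 : C) = 0.
  by apply: h; apply: phi_inj; rewrite phi_cscale phi_zero scaler0.
by rewrite oner_eq0.
Qed.

Lemma selfadjoint_not_type_II : ~ petrov_type_II star S.
Proof. by case=> _; case: selfadjoint_type_I. Qed.

Lemma selfadjoint_not_type_III : ~ petrov_type_III star S.
Proof.
by case=> _; apply; case: selfadjoint_type_I => /independent_eigenvectors_pred.
Qed.

End ComplexLinearMap.

End ComplexStructure.

(** * Critical points on the unit planes *)

Section CurveDerivatives.
Variables (R : realType) (c : R -> bivector R).
Hypothesis c_smooth : smooth_curve c.

(** The entries are the derivatives at 0 of the entries of c; the expansion of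
    [bivector_sum] makes the result antisymmetric by construction. *)
Definition velocity : bivector R := \sum_(i < 4) \sum_(j < 4)
  (2^-1 * 'D_1 (fun t => c t i j) 0) *: wedge (coord_vec R i) (coord_vec R j).

Lemma curve_derivable i j : derivable (fun t => c t i j) 0 1.
Proof. by have := @c_smooth i j 0%N 0; rewrite derive1n0. Qed.

Lemma scalar_velocity (f : bivector R -> R) : scalar f ->
  f velocity = \sum_(i < 4) \sum_(j < 4)
    2^-1 * 'D_1 (fun t => c t i j) 0 * f (wedge (coord_vec R i) (coord_vec R j)).
Proof.
move=> lf.
pose h : {scalar bivector R} :=
  HB.pack f (@GRing.isLinear.Build _ _ _ _ f lf).
rewrite -[f velocity]/((h : _ -> _) velocity) linear_sum.
apply: eq_bigr => i _; rewrite linear_sum; apply: eq_bigr => j _.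
exact: linearZ.
Qed.

Lemma is_derive_scalar_curve (f : bivector R -> R) : scalar f ->
  is_derive (0 : R) (1 : R) (fun t => f (c t)) (f velocity).
Proof.
move=> lf.
have dc i j : derivable (fun t : R => 2^-1 * c t i j *
    f (wedge (coord_vec R i) (coord_vec R j))) 0 1.
  apply: derivableM; last exact: derivable_cst.
  by apply: derivableM; [exact: derivable_cst|exact: curve_derivable].
have -> : (fun t => f (c t)) = (fun t => \sum_(i < 4) \sum_(j < 4)
    2^-1 * c t i j * f (wedge (coord_vec R i) (coord_vec R j))).
  by apply/funext => t; exact: scalar_bivector_sum.
apply: DeriveDef.
  by apply: derivable_bigsum => i; apply: derivable_bigsum => j.
rewrite derive_bigsum => [|i]; last by apply: derivable_bigsum => j.
rewrite scalar_velocity //.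
apply: eq_bigr => i _; rewrite derive_bigsum //; apply: eq_bigr => j _.
set k := f _.
have -> : (fun t : R => 2^-1 * c t i j * k) =
    (2^-1 * k) \*o (fun t => c t i j).
  by apply/funext => t /=; ring.
rewrite deriveMl; last exact: curve_derivable.
by rewrite mulrAC.
Qed.

Lemma is_derive_bilinear_curve (B : bivector R -> bivector R -> R) :
  bilinear_form B ->
  is_derive (0 : R) (1 : R) (fun t => B (c t) (c t))
    (B velocity (c 0) + B (c 0) velocity).
Proof.
move=> [r l].
have dl i j := is_derive_scalar_curve
  (r (wedge (coord_vec R i) (coord_vec R j))).
have dF i j : is_derive (0 : R) (1 : R) (fun t => 2^-1 * c t i j *
    B (wedge (coord_vec R i) (coord_vec R j)) (c t))
   (2^-1 * 'D_1 (fun t => c t i j) 0 *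
      B (wedge (coord_vec R i) (coord_vec R j)) (c 0) +
    2^-1 * c 0 i j * B (wedge (coord_vec R i) (coord_vec R j)) velocity).
  have d1 : is_derive (0 : R) (1 : R) (2^-1 \*o (fun t => c t i j))
      (2^-1 * 'D_1 (fun t => c t i j) 0).
    apply: DeriveDef; first by apply: derivableM;
      [exact: derivable_cst|exact: curve_derivable].
    by rewrite deriveMl //; exact: curve_derivable.
  apply: is_derive_eq (is_deriveM d1 (dl i j)) _.
  by rewrite addrC; congr (_ + _); exact: mulrC.
have -> : (fun t => B (c t) (c t)) = (fun t => \sum_(i < 4) \sum_(j < 4)
    2^-1 * c t i j * B (wedge (coord_vec R i) (coord_vec R j)) (c t)).
  by apply/funext => t; exact: (scalar_bivector_sum (l (c t))).
apply: DeriveDef.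
  by apply: derivable_bigsum => i; apply: derivable_bigsum => j; exact: ex_derive.
rewrite derive_bigsum => [|i]; last first.
  by apply: derivable_bigsum => j; exact: ex_derive.
rewrite [B (c 0) velocity](scalar_bivector_sum (l _)).
rewrite (scalar_velocity (l (c 0))) -big_split; apply: eq_bigr => i _.
rewrite derive_bigsum => [|j]; last exact: ex_derive.
by rewrite -big_split; apply: eq_bigr => j _; exact: derive_val.
Qed.

End CurveDerivatives.

Section CriticalPoints.
Variables (R : realType) (m : 'M[R]_4).
Variable S : {linear bivector R -> bivector R}.
Hypothesis m_sym : forall xi zeta, biform m xi zeta = biform m zeta xi.

(** The square of g_L(c, c) is 1 along a curve c of unit planes, so the
    derivative V of c at P satisfies g_L(V, P) = 0, and only the second factor
    of the sectional curvature contributes to its derivative. *)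
Lemma critical_point_criterion P :
  (forall V, biform m V P = 0 ->
     biform m (S V) P + biform m (S P) V = 0) ->
  is_critical_point (unit_planes m) (sec_LS m S) P.
Proof.
move=> crit c cs cG c0.
have bB := biform_bilinear m.
have dq := is_derive_bilinear_curve cs bB.
have sB : bilinear_form (fun xi zeta => biform m (S xi) zeta).
  have [r l] := bB.
  by split=> [xi a z1 z2|zeta a z1 z2]; [exact: r|rewrite linearP; exact: l].
have ds := is_derive_bilinear_curve cs sB.
have q2 t : biform m (c t) (c t) * biform m (c t) (c t) = 1.
  by have [_ [->|->]] := cG t; rewrite ?mulrNN mulr1.
set V := velocity c in dq ds.
have V0 : biform m V P = 0.
  have dq2 := is_deriveM dq dq.
  have E : (fun t => biform m (c t) (c t)) * (fun t => biform m (c t) (c t)) =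
    cst 1.
    by apply/funext => t; exact: q2.
  rewrite E in dq2.
  have := @derive_val _ _ _ _ _ _ _ dq2; rewrite derive_cst c0 (m_sym P V).
  move=> /esym; rewrite -[_ *: _]/(biform m P P * (biform m V P + biform m V P)).
  have := q2 0; rewrite c0 => q1 h.
  have {}h : biform m P P * biform m V P = 0 by lra.
  by rewrite -[LHS]mul1r -q1 -mulrA h mulr0.
apply: is_derive_eq (is_deriveM dq ds) _.
rewrite c0 crit // (m_sym P V) V0 addr0.
by rewrite !scaler0 addr0.
Qed.

End CriticalPoints.

(** * The operators of a unit vector field *)

Section CurvatureOperator.
Variable R : realType.

Lemma biform_sym (m : 'M[R]_4) : m^T = m ->
  forall xi zeta, biform m xi zeta = biform m zeta xi.
Proof.
move=> m_sym; have [r l] := biform_bilinear m.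
apply: (@bilinear_form_ext _ (biform m) (fun xi zeta => biform m zeta xi)).
- by split.
- by split.
have inner_sym v w : inner m v w = inner m w v.
  rewrite /inner -[in RHS](trmxK (w *m m *m v^T)) [RHS]mxE.
  by rewrite !trmx_mul trmxK m_sym mulmxA.
move=> i j k l'; rewrite !biform_wedge.
rewrite (inner_sym (coord_vec R k) (coord_vec R i)).
rewrite (inner_sym (coord_vec R l') (coord_vec R j)).
rewrite (inner_sym (coord_vec R k) (coord_vec R j)).
by rewrite (inner_sym (coord_vec R l') (coord_vec R i)); ring.
Qed.

(** Only the coordinate bivectors matter, and for them this is the pair
    symmetry. *)
Lemma curvature_operator_selfadjoint (U : set 'rV[R]_4)
    (g : 'rV[R]_4 -> 'M[R]_4) (x : 'rV[R]_4)
    (Rhat : {linear bivector R -> bivector R}) :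
  open U -> (forall i j, smooth U (fun x => g x i j)) ->
  (forall x, U x -> (g x)^T = g x) -> (forall x, U x -> g x \in unitmx) ->
  U x -> is_curvature_operator g x Rhat ->
  forall xi zeta, biform (g x) (Rhat xi) zeta = biform (g x) xi (Rhat zeta).
Proof.
move=> oU g_smooth g_sym g_unit Ux Rh.
have bB := biform_bilinear (g x).
apply: (@bilinear_form_ext _ (fun xi zeta => biform (g x) (Rhat xi) zeta)
  (fun xi zeta => biform (g x) xi (Rhat zeta))).
- exact: (@bilinear_form_comp _ _ Rhat idfun bB).
- exact: (@bilinear_form_comp _ _ idfun Rhat bB).
move=> i j k l; rewrite [RHS](biform_sym (g_sym _ Ux)) !Rh.
by rewrite (curvature_coord_pair_sym oU g_smooth g_sym g_unit i j k l Ux).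
Qed.

Lemma posdef_unitmx (m : 'M[R]_4) :
  (forall v : 'rV[R]_4, v != 0 -> 0 < (v *m m *m v^T) 0 0) -> m \in unitmx.
Proof.
move=> pos; rewrite unitmxE unitfE; apply/det0P => -[v v0 vm].
by have := pos v v0; rewrite vm mul0mx mxE ltxx.
Qed.

End CurvatureOperator.

Section LorentzSelfadjoint.
Variables (R : realType) (g E : 'M[R]_4) (T : 'rV[R]_4).
Hypothesis g_sym : g^T = g.
Hypothesis Eg : E *m g *m E^T = 1%:M.
Hypothesis E0 : row 0 E = T.
Hypothesis detE : 0 < \det E.
Variables star Rhat : {linear bivector R -> bivector R}.
Local Notation gL := (lorentz_metric g T).
Local Notation C := R[i].
Local Notation cscale := Defs.cscale.
Hypothesis star_hodge : is_hodge_star gL star.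
Hypothesis Rhat_selfadjoint : forall xi zeta,
  biform g (Rhat xi) zeta = biform g xi (Rhat zeta).
Local Notation phi := (fvec E).
Local Notation S := (S_operator star Rhat).

Let phiP := fvecP E.
Let phiK := fvecK detE.
Let psiK := fbivK detE.
Let phi_star := hodge_star_fvec Eg E0 detE star_hodge.

Lemma hodge_star_star xi : star (star xi) = - xi.
Proof. exact: (star_star phiP phiK phi_star). Qed.

Lemma S_linear : linear S.
Proof.
move=> a xi zeta.
rewrite /S_operator (linearP star) !(linearP Rhat) (linearP star).
by rewrite opprD addrACA -scalerBr scalerDr !scalerA [_^-1 * a]mulrC.
Qed.

Lemma S_star xi : S (star xi) = star (S xi).
Proof.
rewrite /S_operator hodge_star_star [star (_ *: _)]linearZ [star (_ - _)]linearB /=.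
by rewrite hodge_star_star linearN linearN /= !opprK addrC.
Qed.

Lemma S_clinear : clinear star S.
Proof.
by move=> z xi zeta; rewrite /Defs.cscale -addrA !S_linear S_star addrA.
Qed.

(** Multiplication by i is anti-Hermitian. *)
Lemma star_antiselfadjoint xi zeta :
  biform g (star xi) zeta = - biform g xi (star zeta).
Proof.
rewrite !(biform_riemann Eg detE) !phi_star /hdot !big_ord3 !mxE.
case: (phi xi 0 0) (phi xi 0 1) (phi xi 0 2%:R) => a b [c d] [e f].
case: (phi zeta 0 0) (phi zeta 0 1) (phi zeta 0 2%:R) => a' b' [c' d'] [e' f'].
by rewrite /=; ring.
Qed.

(** star R^ star is selfadjoint because the two signs coming from
    [star_antiselfadjoint] cancel. *)
Lemma S_selfadjoint xi zeta : biform g (S xi) zeta = biform g xi (S zeta).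
Proof.
have [r l] := biform_bilinear g.
have half (f : bivector R -> R) (x y : bivector R) : scalar f ->
    f (2^-1 *: (x - y)) = 2^-1 * (f x - f y).
  move=> lf.
  pose h : {scalar bivector R} :=
    HB.pack f (@GRing.isLinear.Build _ _ _ _ f lf).
  by rewrite -[f _]/((h : _ -> _) _) linearZ linearB.
rewrite /S_operator (half _ _ _ (l zeta)) (half _ _ _ (r xi)).
rewrite (Rhat_selfadjoint xi) (star_antiselfadjoint (Rhat _)).
by rewrite (Rhat_selfadjoint (star xi)) star_antiselfadjoint opprK.
Qed.

Lemma S_hdot_selfadjoint xi zeta :
  complex.Re (hdot (phi (S xi)) (phi zeta)) =
  complex.Re (hdot (phi xi) (phi (S zeta))).
Proof. by rewrite -!(biform_riemann Eg detE) S_selfadjoint. Qed.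

Lemma star_unit_plane P : unit_planes gL P -> unit_planes gL (star P).
Proof.
have cdot_star xi : cdot (phi (star xi)) (phi (star xi)) =
    - cdot (phi xi) (phi xi).
  rewrite !phi_star /cdot -sumrN; apply: eq_bigr => k _.
  by rewrite !mxE mulrACA -expr2 sqr_i mulN1r.
case=> /(decomposableP detE) dP bP; split.
  by apply/(decomposableP detE); rewrite cdot_star; move: dP;
    case: (cdot _ _) => a b /= ->; rewrite oppr0.
move: bP; rewrite !(biform_lorentz Eg E0 detE) cdot_star.
by case: (cdot _ _) => a b /= [ba|ba]; [right|left]; rewrite ba ?opprK.
Qed.

Lemma biform_star xi zeta : biform gL (star xi) (star zeta) = - biform gL xi zeta.
Proof.
rewrite !(biform_lorentz Eg E0 detE) !phi_star.
rewrite (_ : cdot _ _ = - cdot (phi xi) (phi zeta)).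
  by case: (cdot _ _) => a b.
rewrite /cdot -sumrN; apply: eq_bigr => k _.
by rewrite !mxE mulrACA -expr2 sqr_i mulN1r.
Qed.

Lemma biform_star_sym xi zeta :
  biform gL (star xi) zeta = biform gL xi (star zeta).
Proof.
rewrite !(biform_lorentz Eg E0 detE) !phi_star /cdot.
by congr (- complex.Re _); apply: eq_bigr => k _; rewrite !mxE mulrCA mulrA.
Qed.

Lemma sec_star P : sec_LS gL S (star P) = sec_LS gL S P.
Proof. by rewrite /sec_LS S_star !biform_star mulrNN. Qed.

(** The condition on the coordinates of P makes g_L(V, P) a multiple of
    g(V, P), so that the selfadjointness of S for g can be used. *)
Lemma eigenplane_critical P : ceigenvector star S P ->
  (exists e : R, forall k, (phi P 0 k)^* = (e%:C)%C * phi P 0 k) ->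
  is_critical_point (unit_planes gL) (sec_LS gL S) P.
Proof.
move=> [_ [z SP]] [e Pe].
have [rL lL] := biform_bilinear gL; have [rg lg] := biform_bilinear g.
pose Sl : {linear bivector R -> bivector R} :=
  HB.pack S (@GRing.isLinear.Build _ _ _ _ S S_linear).
have gL_sym : gL^T = gL.
  rewrite /lorentz_metric linearB linearZ /= g_sym; congr (_ - _ *: _).
  by rewrite trmx_mul trmxK.
have Pe' k : phi P 0 k = (e%:C)%C * (phi P 0 k)^*.
  have := Pe k; case: (phi P 0 k) => u v /= [h1 h2].
  by apply: complex_eq => /=; lra.
have bP V : biform gL V P = - e * biform g V P.
  rewrite (biform_lorentz Eg E0 detE) (biform_riemann Eg detE) mulNr.
  rewrite (_ : cdot _ _ = (e%:C)%C * hdot (phi V) (phi P)).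
    by case: (hdot _ _) => x y /=; ring.
  rewrite mulr_sumr; apply: eq_bigr => k _.
  by rewrite [in LHS]Pe' mulrCA.
apply: (@critical_point_criterion _ _ Sl (biform_sym gL_sym) P) => V VP.
rewrite -[Sl V]/(S V) -[Sl P]/(S P) bP S_selfadjoint SP /Defs.cscale.
have VP' : e * biform g V P = 0.
  by move: VP; rewrite bP mulNr => /eqP; rewrite oppr_eq0 => /eqP.
rewrite -[complex.Im z *: _]addr0 !(rg, lL).
have E1 : biform g V (star P) = - biform g (star V) P.
  by rewrite star_antiselfadjoint opprK.
have E2 : biform gL (star P) V = - e * biform g (star V) P.
  by rewrite -bP biform_star_sym (biform_sym gL_sym).
have bg0 xi : biform g xi 0 = 0.
  by have := rg xi 1 0 0; rewrite scaler0 addr0; lra.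
have bL0 xi : biform gL 0 xi = 0.
  by have := lL xi 1 0 0; rewrite scaler0 addr0; lra.
rewrite E1 E2 bg0 bL0 (biform_sym gL_sym P V) VP.
by ring: VP'.
Qed.

End LorentzSelfadjoint.

Theorem theorem5 (R : realType) (M : oriented_manifold4 R)
  (g : riemannian_metric M) (T : vector_field M)
  (T_unit : forall (a : chart_index M) (x : 'rV[R]_4), chart_img a x ->
     inner (metric g a x) (field_comp T a x) (field_comp T a x) = 1)
  (p : M) (a : chart_index M) (pa : chart_dom a p)
  (starL Rhat : {linear bivector R -> bivector R}) :
  let x := chart a p in
  let Tp := field_comp T a x in
  let gp := metric g a x in
  let gL := lorentz_metric gp Tp in
  let S := S_operator starL Rhat in
  let sec := sec_LS gL S in
  let G := unit_planes gL in
  is_hodge_star gL starL ->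
  is_curvature_operator (metric g a) x Rhat ->
  [/\ (forall xi, S (starL xi) = starL (S xi)) /\ clinear starL S,
      forall P, G P -> G (starL P) /\ sec (starL P) = sec P,
      [/\ [\/ petrov_type_I starL S, petrov_type_II starL S
            | petrov_type_III starL S],
          petrov_type_I starL S -> exists l1 l2 l3 : R[i],
            csimilar starL S (mx3 [:: [:: l1; 0; 0];
                                      [:: 0; l2; 0];
                                      [:: 0; 0; l3]]),
          petrov_type_II starL S -> exists l1 l2 : R[i],
            csimilar starL S (mx3 [:: [:: l1; 0; 0];
                                      [:: 0; l2; 1];
                                      [:: 0; 0; l2]])
        & petrov_type_III starL S -> exists l1 : R[i],
            csimilar starL S (mx3 [:: [:: l1; 1; 0];
                                      [:: 0; l1; 1];
                                      [:: 0; 0; l1]])]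
    & forall P, G P -> ceigenvector starL S P ->
        (forall u, in_plane P u -> inner gp Tp u = 0) \/ in_plane P Tp ->
        is_critical_point G sec P].
Proof.
move=> x Tp gp gL S sec G star_hodge Rhat_op.
have ax : chart_img a x by exists p.
have oU : open (chart_img a) by exact: chart_img_open.
have g_sym y : chart_img a y -> (metric g a y)^T = metric g a y.
  by move=> ay; exact: (@Defs.metric_sym _ _ g).
have g_unit y : chart_img a y -> metric g a y \in unitmx.
  by move=> ay; apply: posdef_unitmx; exact: (@Defs.metric_pos _ _ g).
have Rhat_sa := curvature_operator_selfadjoint oU
  (@Defs.metric_smooth _ _ g a) g_sym g_unit ax Rhat_op.
have T1 : Tp *m gp *m Tp^T = 1%:M.
  by rewrite [LHS]mx11_scalar; congr (_%:M); exact: T_unit.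
have [E [Eg E0 detE]] :=
  orthonormal_frame (g_sym _ ax) (@Defs.metric_pos _ _ g _ _ ax) T1.
have phiP := fvecP E; have phiK := fvecK detE; have psiK := fbivK detE.
have phi_star := hodge_star_fvec Eg E0 detE star_hodge.
have Scl := S_clinear Eg E0 detE Rhat star_hodge.
have Ssa := S_hdot_selfadjoint Eg E0 detE star_hodge Rhat_sa.
split.
- split=> // xi; exact: (S_star Eg E0 detE Rhat star_hodge).
- move=> P GP; split; first exact: (star_unit_plane Eg E0 detE star_hodge GP).
  exact: (sec_star Eg E0 detE Rhat star_hodge).
- have nII := selfadjoint_not_type_II phiP phiK psiK phi_star Scl Ssa.
  have nIII := selfadjoint_not_type_III phiP phiK psiK phi_star Scl Ssa.
  split=> //.
  + by apply: Or31; exact: (selfadjoint_type_I phiP phiK psiK phi_star Scl Ssa).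
  + move=> _.
    exact: (selfadjoint_petrov phiP phiK psiK phi_star Scl Ssa).
- move=> P [decP _] eigP TP.
  apply: (eigenplane_critical (g_sym _ ax) Eg E0 detE star_hodge Rhat_sa eigP).
  case: TP => [orth|cont]; [exists (-1)|exists 1] => k.
    by rewrite (fvec_orthogonal Eg E0 detE decP orth) rmorphN1 mulN1r.
  by rewrite (fvec_containing E0 detE cont) rmorph1 mul1r.
Qed.
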